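(* Let $\mathbb{k}$ be a field, $n\ge 2$, $B=\mathbb{k}[x]/(x^n)$, and let $A[\overline{x};\sigma,\delta]=A\otimes_\tau B$ be a truncated Ore extension. Let $M$ be a left $A[\overline{x};\sigma,\delta]$-module for which there is an isomorphism $\phi:M\to M^\sigma$ of left $A$-modules, and suppose $M$ is compatible with $\tau$ via $\tau_{B,M}$. Let $P_\bullet(M)$ be a free resolution of $M$ as a left $A$-module. Let $\sigma_\bullet$ and $\delta_\bullet$ be the $\mathbb{k}$-linear chain maps on $P_\bullet(M)$ described in the context, and assume that $P_\bullet(M)$ is compatible with $\tau$ via the chain map $\tau_{B,\bullet}$ (described in the context) built from $\sigma_\bullet$ and $\delta_\bullet$. Suppose that $\sigma_i:P_i(M)\to P_i(M)$ is bijective for each $i\ge 0$. Then the twisted product complex of $P_\bullet(M)$ and $P_\bullet(B)$ gives a projective resolution of $M$ as a left $A[\overline{x};\sigma,\delta]$-module, where $P_\bullet(B)$ is the standard projective resolution $$\cdots\xrightarrow{\ x\cdot\ }B\xrightarrow{\ x^{n-1}\cdot\ }B\xrightarrow{\ x\cdot\ }B\xrightarrow{\ \epsilon_B\ }\mathbb{k}\to 0$$ of $\mathbb{k}$ as a $B$-module, with $\epsilon_B(\overline{x})=0$ (and $M\otimes\mathbb{k}$ is identified with $M$).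
   Context: All tensor products without subscript are over $\mathbb{k}$; algebras are associative and unital, $m_A,m_B$ are multiplication maps, $\rho_{A,M}:A\otimes M\to M$ denotes a module structure map. Twisting map: a bijective $\mathbb{k}$-linear $\tau:B\otimes A\to A\otimes B$ with $\tau(1\otimes a)=a\otimes1$, $\tau(b\otimes1)=1\otimes b$ and $\tau(m_B\otimes m_A)=(m_A\otimes m_B)(1\otimes\tau\otimes1)(\tau\otimes\tau)(1\otimes\tau\otimes1)$. $A\otimes_\tau B$ is $A\otimes B$ with multiplication $(m_A\otimes m_B)(1\otimes\tau\otimes1)$. Truncated Ore extension: let $\sigma$ be a $\mathbb{k}$-algebra automorphism of $A$ and $\delta:A\to A$ a left $\sigma$-derivation ($\mathbb{k}$-linear, $\delta(aa')=\delta(a)a'+\sigma(a)\delta(a')$). For linear endomorphisms $f,g$, $s_{(i,j)}(f,g)$ is the sum of all distinct compositions using exactly $i$ copies of $f$ and $j$ copies of $g$. Assume $s_{(i,j)}(\sigma,\delta)=0$ for all $i+j=n$, $j\ge1$. Then $\tau(\overline{x}\otimes a)=\sigma(a)\otimes\overline{x}+\delta(a)\otimes1$ determines a twisting map $\tau:B\otimes A\to A\otimes B$, and $A[\overline{x};\sigma,\delta]=A\otimes_\tau B$ is the algebra generated by $A$ and $\overline{x}$ with $\overline{x}^n=0$, $\overline{x}a=\sigma(a)\overline{x}+\delta(a)$. $M^\sigma$ is the vector space $M$ with action $a\cdot_\sigma m=\sigma(a)\cdot m$. Compatibility: a left $A$-module $M$ is compatible with $\tau$ (via $\tau_{B,M}$)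 if $\tau_{B,M}:B\otimes M\to M\otimes B$ is a bijective $\mathbb{k}$-linear map with (i) $\tau_{B,M}(m_B\otimes1)=(1\otimes m_B)(\tau_{B,M}\otimes1)(1\otimes\tau_{B,M})$, and (ii) $\tau_{B,M}(1\otimes\rho_{A,M})=(\rho_{A,M}\otimes1)(1\otimes\tau_{B,M})(\tau\otimes1)$. A resolution $P_\bullet(M)$ is compatible with $\tau$ via $\tau_{B,\bullet}$ if $\tau_{B,\bullet}:B\otimes P_\bullet(M)\to P_\bullet(M)\otimes B$ is a chain map lifting $\tau_{B,M}$ such that each $P_i(M)$ is compatible with $\tau$ via $\tau_{B,i}$. Here $\tau_{B,M}$ is the $\mathbb{k}$-linear map with $\tau_{B,M}(1\otimes m)=m\otimes1$, $\tau_{B,M}(\overline{x}\otimes m)=\phi(m)\otimes\overline{x}+\overline{x}\cdot m\otimes1$, extended to $\overline{x}^k\otimes m$ ($k\le n-1$) by iterating (i), so $\tau_{B,M}(\overline{x}^k\otimes m)=\sum_{i+j=k}s_{(i,j)}(\phi,\overline{x}\cdot)(m)\otimes\overline{x}^i$. Write $P_\bullet(M):\cdots\xrightarrow{d_2}P_1(M)\xrightarrow{d_1}P_0(M)\xrightarrow{\mu}M\to0$. - $\sigma_\bullet$: an $A$-module chain map from $P_\bullet(M)$ to the resolution $P^\sigma_\bullet(M):\cdots\to P_1(M)^\sigma\xrightarrow{d_1}P_0(M)^\sigma\xrightarrow{\phi^{-1}\mu}M\to0$ lifting the identity of $M$, viewed as $\mathbb{k}$-linear maps $\sigma_i:P_i(M)\to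 P_i(M)$; thus $\sigma_i(az)=\sigma(a)\sigma_i(z)$, $d_i\sigma_i=\sigma_{i-1}d_i$, $\phi^{-1}\mu\sigma_0=\mu$. - $\delta_\bullet$: a $\mathbb{k}$-linear chain map $P_\bullet(M)\to P_\bullet(M)$ lifting the map $M\to M$, $m\mapsto\overline{x}\cdot m$, with $\delta_i(az)=\sigma(a)\delta_i(z)+\delta(a)z$ for all $a\in A$, $z\in P_i(M)$ (such a chain map exists). - $\tau_{B,i}:B\otimes P_i(M)\to P_i(M)\otimes B$ is the $\mathbb{k}$-linear map with $\tau_{B,i}(1\otimes z)=z\otimes 1$, $\tau_{B,i}(\overline{x}\otimes z)=\sigma_i(z)\otimes\overline{x}+\delta_i(z)\otimes1$, extended by iterating (i): $\tau_{B,i}(\overline{x}^l\otimes z)=\sum_{k+j=l}s_{(k,j)}(\sigma_i,\delta_i)(z)\otimes\overline{x}^k$ for $0\le l\le n-1$. If $M$ is a left $A$-module compatible with $\tau$ via $\tau_{B,M}$ and $N$ a left $B$-module, $M\otimes N$ is a left $A\otimes_\tau B$-module via $(\rho_{A,M}\otimes\rho_{B,N})(1\otimes\tau_{B,M}\otimes1)$; likewise $P_i(M)\otimes P_j(N)$ via $\tau_{B,i}$. Twisted product complex of $P_\bullet(M)$ (differentials $d'_i$) and a projective $B$-resolution $P_\bullet(N)$ of $N$ (differentials $d''_j$): the complex $\cdots\to X_1\to X_0\to M\otimes N\to0$ with $X_k=\bigoplus_{i+j=k}P_i(M)\otimes P_j(N)$ and $d_k=\sum_{i+j=k}(d'_i\otimes1+(-1)^i\otimes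 d''_j)$, with augmentation the tensor product of the augmentations. Here $N=\mathbb{k}$ and $P_\bullet(N)=P_\bullet(B)$. *)

(* Defs.v *)
From HB Require Import structures.
From mathcomp Require Import all_boot all_order all_algebra.
From mathcomp Require Import boolp zify.

Set Implicit Arguments.
Unset Strict Implicit.
Unset Printing Implicit Defensive.

Import GRing.Theory.
Local Open Scope ring_scope.
Local Open Scope quotient_scope.

(* World: Mathematical Components, with classical logic from boolp.            *)

Notation bilin f := (bilinear_for *:%R *:%R f).

Section Tensor.
Variables (K : fieldType) (U V : lmodType K).

(* U \ot V as a quotient of formal sums of pairs (u, v), represented by lists: *)
(* two of them are identified when no bilinear map separates them.  The       *)
(* universal property is given by [tlift_linear], [tlift_pure] and [tens_ext]. *)
Definition tens_rel : rel (seq (U * V)) := fun s t =>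
  `[< forall (W : lmodType K) (f : U -> V -> W), bilin f ->
        \sum_(p <- s) f p.1 p.2 = \sum_(p <- t) f p.1 p.2 >].

Fact tens_rel_equiv : equiv_class_of tens_rel.
Proof.
split=> [s|s t|t s u].
- by apply/asboolP.
- by apply/asboolP/asboolP => h W f bf; rewrite h.
- move=> /asboolP h1 /asboolP h2; apply/asboolP => W f bf.
  by rewrite h1 ?h2.
Qed.

Canonical tens_equiv := EquivRelPack tens_rel_equiv.

Definition tens := {eq_quot tens_equiv}.
HB.instance Definition _ := EqQuotient.on tens.
HB.instance Definition _ := Choice.on tens.

Definition pure (u : U) (v : V) : tens := \pi_tens [:: (u, v)].

(* Linear map induced by a bilinear f; meaningless when f is not bilinear.    *)
Definition tlift (W : lmodType K) (f : U -> V -> W) (t : tens) : W :=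
  \sum_(p <- repr t) f p.1 p.2.

Lemma tlift_pi (W : lmodType K) (f : U -> V -> W) s :
  bilin f -> tlift f (\pi_tens s) = \sum_(p <- s) f p.1 p.2.
Proof.
move=> bf; rewrite /tlift; case: piP => t /eqmodP /asboolP h.
exact/esym/h.
Qed.

Lemma tens_eqP (t u : tens) :
  (forall (W : lmodType K) (f : U -> V -> W), bilin f -> tlift f t = tlift f u) ->
  t = u.
Proof.
move=> h; rewrite -[t]reprK -[u]reprK; apply/eqmodP/asboolP => W f bf.
exact: h.
Qed.

Lemma bilin0 (W : lmodType K) (f : U -> V -> W) v : bilin f -> f 0 v = 0.
Proof.
by case=> /(_ v) h _; have := h (-1) 0 0; rewrite /= scaler0 addr0 scaleN1r addNr.
Qed.

Definition tens_zero : tens := \pi_tens [::].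
Definition tens_add (t u : tens) : tens := \pi_tens (repr t ++ repr u).
Definition tens_scale (c : K) (t : tens) : tens :=
  \pi_tens [seq (c *: p.1, p.2) | p <- repr t].

Let tlift_zero (W : lmodType K) (f : U -> V -> W) : bilin f -> tlift f tens_zero = 0.
Proof. by move=> bf; rewrite tlift_pi // big_nil. Qed.

Let tlift_add (W : lmodType K) (f : U -> V -> W) t u : bilin f ->
  tlift f (tens_add t u) = tlift f t + tlift f u.
Proof. by move=> bf; rewrite tlift_pi // big_cat. Qed.

Let tlift_scale (W : lmodType K) (f : U -> V -> W) c t : bilin f ->
  tlift f (tens_scale c t) = c *: tlift f t.
Proof.
move=> bf; rewrite tlift_pi // big_map scaler_sumr; apply: eq_bigr => p _ /=.
by have := bf.1 p.2 c p.1 0; rewrite /= !addr0 (bilin0 _ bf) addr0.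
Qed.

Let tl := (tlift_zero, tlift_add, tlift_scale).

Fact tens_addA : associative tens_add.
Proof. by move=> t u v; apply: tens_eqP => W f bf; rewrite !tl // addrA. Qed.
Fact tens_addC : commutative tens_add.
Proof. by move=> t u; apply: tens_eqP => W f bf; rewrite !tl // addrC. Qed.
Fact tens_add0 : left_id tens_zero tens_add.
Proof. by move=> t; apply: tens_eqP => W f bf; rewrite !tl // add0r. Qed.
Fact tens_addN : left_inverse tens_zero (tens_scale (-1)) tens_add.
Proof. by move=> t; apply: tens_eqP => W f bf; rewrite !tl // scaleN1r addNr. Qed.

HB.instance Definition _ :=
  GRing.isZmodule.Build tens tens_addA tens_addC tens_add0 tens_addN.

Fact tens_scaleA a b t : tens_scale a (tens_scale b t) = tens_scale (a * b) t.
Proof. by apply: tens_eqP => W f bf; rewrite !tl // scalerA. Qed.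
Fact tens_scale1 : left_id 1 tens_scale.
Proof. by move=> t; apply: tens_eqP => W f bf; rewrite !tl // scale1r. Qed.
Fact tens_scaleDr : right_distributive tens_scale +%R.
Proof. by move=> a t u; apply: tens_eqP => W f bf; rewrite !tl // scalerDr. Qed.
Fact tens_scaleDl t : {morph tens_scale^~ t : a b / a + b}.
Proof. by move=> a b; apply: tens_eqP => W f bf; rewrite !tl // scalerDl. Qed.

HB.instance Definition _ := GRing.Zmodule_isLmodule.Build K tens
  tens_scaleA tens_scale1 tens_scaleDr tens_scaleDl.

Lemma tlift_linear (W : lmodType K) (f : U -> V -> W) : bilin f -> linear (tlift f).
Proof. by move=> bf c t u; rewrite tlift_add // tlift_scale. Qed.

Lemma tlift_pure (W : lmodType K) (f : U -> V -> W) u v :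
  bilin f -> tlift f (pure u v) = f u v.
Proof. by move=> bf; rewrite tlift_pi // big_seq1. Qed.

Lemma bilin_pure : bilin pure.
Proof.
split=> [v c u u'|u c v v']; apply: tens_eqP => W f bf;
  rewrite tlift_linear // !tlift_pure //; first exact: bf.1.
exact: bf.2.
Qed.

Lemma tens_sum (t : tens) : t = \sum_(p <- repr t) pure p.1 p.2.
Proof.
apply: tens_eqP => W f bf; rewrite -{1}[t]reprK tlift_pi //.
have -> : \sum_(p <- repr t) pure p.1 p.2 = \pi_tens (repr t).
  elim: (repr t) => [|p s ih]; first by rewrite big_nil.
  rewrite big_cons ih; apply: tens_eqP => W' g bg.
  by rewrite tlift_add // !tlift_pi // big_seq1 big_cons.
by rewrite tlift_pi.
Qed.

Lemma tens_ind (P : tens -> Prop) :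
  P 0 -> (forall t u, P t -> P u -> P (t + u)) -> (forall u v, P (pure u v)) ->
  forall t, P t.
Proof. by move=> h0 hD hp t; rewrite [t]tens_sum; elim/big_ind: _. Qed.

End Tensor.

Notation "u \ot v" := (pure u v) (at level 40, left associativity) : ring_scope.

Section TensorMaps.
Variable K : fieldType.
Implicit Types U V W : lmodType K.

Lemma pureEl U V c (u u' : U) (v : V) :
  (c *: u + u') \ot v = c *: (u \ot v) + u' \ot v.
Proof. exact: (bilin_pure U V).1. Qed.

Lemma pureEr U V c (u : U) (v v' : V) :
  u \ot (c *: v + v') = c *: (u \ot v) + u \ot v'.
Proof. exact: (bilin_pure U V).2. Qed.

Lemma pure0l U V (v : V) : (0 : U) \ot v = 0.
Proof. exact: bilin0 (bilin_pure U V). Qed.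

Lemma pure0r U V (u : U) : u \ot (0 : V) = 0.
Proof.
have := pureEr (-1) u (0 : V) 0.
by rewrite scaler0 addr0 scaleN1r addNr.
Qed.

Lemma tlift_linearl U V W W' (F : W' -> U -> V -> W) t :
  (forall u v, linear (fun w => F w u v)) -> linear (fun w => tlift (F w) t).
Proof.
move=> hF c w w'; rewrite /tlift scaler_sumr -big_split.
by apply: eq_bigr => p _; rewrite hF.
Qed.

Lemma tens_ext U V W (f g : tens U V -> W) :
  linear f -> linear g -> (forall u v, f (u \ot v) = g (u \ot v)) -> f =1 g.
Proof.
move=> lf lg h; elim/tens_ind => [|t u ht hu|] //.
  have := lf (-1) 0 0; have := lg (-1) 0 0.
  by rewrite !scaler0 !addr0 !scaleN1r !addNr => -> ->.
by have := lf 1 t u; have := lg 1 t u; rewrite !scale1r => -> ->; rewrite ht hu.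
Qed.

Definition tmap U U' V V' (f : {linear U -> U'}) (g : {linear V -> V'}) :
  tens U V -> tens U' V' := tlift (fun u v => f u \ot g v).

Fact tmap_bilin U U' V V' (f : {linear U -> U'}) (g : {linear V -> V'}) :
  bilin (fun u v => f u \ot g v).
Proof. by split=> ? c ? ?; rewrite linearP (pureEl, pureEr). Qed.

HB.instance Definition _ U U' V V' (f : {linear U -> U'}) (g : {linear V -> V'}) :=
  GRing.isLinear.Build K (tens U V) (tens U' V') _ (tmap f g)
    (tlift_linear (tmap_bilin f g)).

Lemma tmapE U U' V V' (f : {linear U -> U'}) (g : {linear V -> V'}) u v :
  tmap f g (u \ot v) = f u \ot g v.
Proof. exact: tlift_pure (tmap_bilin f g). Qed.

Definition tassoc U V W : tens (tens U V) W -> tens U (tens V W) :=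
  tlift (fun t w => tlift (fun u v => u \ot (v \ot w)) t).

Fact tassoc_bilin1 U V W (w : W) :
  bilin (fun (u : U) (v : V) => u \ot (v \ot w)).
Proof. by split=> ? c ? ?; rewrite ?pureEl ?pureEr. Qed.

Fact tassoc_bilin U V W :
  bilin (fun t (w : W) => tlift (fun (u : U) (v : V) => u \ot (v \ot w)) t).
Proof.
split=> [w|t]; first exact: tlift_linear (tassoc_bilin1 _ _ w).
by apply: tlift_linearl => u v c w w'; rewrite !pureEr.
Qed.

HB.instance Definition _ U V W :=
  GRing.isLinear.Build K (tens (tens U V) W) (tens U (tens V W)) _
    (@tassoc U V W) (tlift_linear (tassoc_bilin U V W)).

Lemma tassocE U V W (u : U) (v : V) (w : W) :
  tassoc (u \ot v \ot w) = u \ot (v \ot w).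
Proof.
rewrite /tassoc (tlift_pure _ _ (tassoc_bilin U V W)).
exact: tlift_pure (tassoc_bilin1 _ _ w).
Qed.

Definition tassocV U V W : tens U (tens V W) -> tens (tens U V) W :=
  tlift (fun u t => tlift (fun v w => (u \ot v) \ot w) t).

Fact tassocV_bilin1 U V W (u : U) :
  bilin (fun (v : V) (w : W) => (u \ot v) \ot w).
Proof. by split=> ? c ? ?; rewrite ?pureEr ?pureEl. Qed.

Fact tassocV_bilin U V W :
  bilin (fun (u : U) t => tlift (fun (v : V) (w : W) => (u \ot v) \ot w) t).
Proof.
split=> [t|u]; last exact: tlift_linear (tassocV_bilin1 _ _ u).
by apply: tlift_linearl => v w c u u'; rewrite !pureEl.
Qed.

HB.instance Definition _ U V W :=
  GRing.isLinear.Build K (tens U (tens V W)) (tens (tens U V) W) _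
    (@tassocV U V W) (tlift_linear (tassocV_bilin U V W)).

Lemma tassocVE U V W (u : U) (v : V) (w : W) :
  tassocV (u \ot (v \ot w)) = (u \ot v) \ot w.
Proof.
rewrite /tassocV (tlift_pure _ _ (tassocV_bilin U V W)).
exact: tlift_pure (tassocV_bilin1 _ _ u).
Qed.

(* [tmid th] is the map 1 \ot th \ot 1 on a fourfold tensor product, with the *)
(* factors regrouped in pairs.                                                *)
Definition tmid U V W X V' W' (th : {linear tens V W -> tens W' V'}) :
  tens (tens U V) (tens W X) -> tens (tens U W') (tens V' X) :=
  tlift (fun t s => tlift (fun u v => tlift (fun w x =>
    tlift (fun w' v' => (u \ot w') \ot (v' \ot x)) (th (v \ot w))) s) t).

Section Tmid.
Variables (U V W X V' W' : lmodType K) (th : {linear tens V W -> tens W' V'}).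

Fact tmid_bilin1 (u : U) (x : X) :
  bilin (fun (w' : W') (v' : V') => (u \ot w') \ot (v' \ot x)).
Proof. by split=> ? c ? ?; rewrite ?pureEl ?pureEr ?pureEl. Qed.

Fact tmid_bilin2 (u : U) (v : V) : bilin (fun (w : W) (x : X) =>
  tlift (fun w' v' => (u \ot w') \ot (v' \ot x)) (th (v \ot w))).
Proof.
split=> [x c w w'|w].
  by rewrite pureEr linearP (tlift_linear (tmid_bilin1 _ _)).
by apply: tlift_linearl => w' v' c x x'; rewrite !pureEr.
Qed.

Fact tmid_bilin3 (s : tens W X) : bilin (fun (u : U) (v : V) => tlift (fun w x =>
  tlift (fun w' v' => (u \ot w') \ot (v' \ot x)) (th (v \ot w))) s).
Proof.
split=> [v|u]; apply: tlift_linearl => w x.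
  by apply: tlift_linearl => w' v' c u u'; rewrite !pureEl.
move=> c v v'; rewrite pureEl linearP.
by rewrite (tlift_linear (tmid_bilin1 _ _)).
Qed.

Fact tmid_bilin : bilin (fun (t : tens U V) (s : tens W X) =>
  tlift (fun u v => tlift (fun w x =>
    tlift (fun w' v' => (u \ot w') \ot (v' \ot x)) (th (v \ot w))) s) t).
Proof.
split=> [s|t]; first exact: tlift_linear (tmid_bilin3 s).
by apply: tlift_linearl => u v; apply: tlift_linear (tmid_bilin2 u v).
Qed.

HB.instance Definition _ :=
  GRing.isLinear.Build K (tens (tens U V) (tens W X)) (tens (tens U W') (tens V' X))
    _ (@tmid U V W X V' W' th) (tlift_linear tmid_bilin).

Lemma tmidE (u : U) v w (x : X) : tmid th ((u \ot v) \ot (w \ot x)) =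
  tlift (fun w' v' => (u \ot w') \ot (v' \ot x)) (th (v \ot w)).
Proof.
rewrite /tmid (tlift_pure _ _ tmid_bilin) (tlift_pure _ _ (tmid_bilin3 _)).
exact: tlift_pure (tmid_bilin2 u v).
Qed.

End Tmid.

Definition tmul (A : algType K) : tens A A -> A := tlift (fun a b => a * b).

Fact tmul_bilin (A : algType K) : bilin (fun a b : A => a * b).
Proof.
split=> [b c a a'|a c b b'] /=; first by rewrite mulrDl scalerAl.
by rewrite mulrDr scalerAr.
Qed.

HB.instance Definition _ (A : algType K) :=
  GRing.isLinear.Build K (tens A A) A _ (@tmul A) (tlift_linear (tmul_bilin A)).

Lemma tmulE (A : algType K) (a b : A) : tmul (a \ot b) = a * b.
Proof. exact: tlift_pure (tmul_bilin A). Qed.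

End TensorMaps.

(* Restriction of scalars along f.  Besides genuine restrictions, it gives    *)
(* the twist M^s of an A-module M: restr s M for an endomorphism s of A.      *)
Definition restr (R S : pzRingType) (f : {rmorphism R -> S}) (M : lmodType S) : Type :=
  M.

Section Restr.
Variables (R S : pzRingType) (f : {rmorphism R -> S}) (M : lmodType S).

HB.instance Definition _ := GRing.Zmodule.copy (restr f M) M.

Let scale (r : R) (m : restr f M) : restr f M := f r *: (m : M).

Fact restr_scaleA a b m : scale a (scale b m) = scale (a * b) m.
Proof. by rewrite /scale rmorphM scalerA. Qed.
Fact restr_scale1 : left_id 1 scale.
Proof. by move=> m; rewrite /scale rmorph1 scale1r. Qed.
Fact restr_scaleDr : right_distributive scale +%R.
Proof. by move=> a m m'; rewrite /scale scalerDr. Qed.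
Fact restr_scaleDl m : {morph scale^~ m : a b / a + b}.
Proof. by move=> a b; rewrite /scale rmorphD scalerDl. Qed.

HB.instance Definition _ := GRing.Zmodule_isLmodule.Build R (restr f M)
  restr_scaleA restr_scale1 restr_scaleDr restr_scaleDl.

End Restr.

Lemma restrE (R S : pzRingType) (f : {rmorphism R -> S}) (M : lmodType S)
  (r : R) (m : restr f M) : r *: m = f r *: (m : M).
Proof. by []. Qed.

Section Kmod.
Variables (K : fieldType) (A : algType K).

(* The vector space underlying a module over a K-algebra.                     *)
Definition kmod (M : lmodType A) : lmodType K := restr (GRing.in_alg A) M.

Lemma kmodE (M : lmodType A) (c : K) (m : M) :
  c *: (m : kmod M) = (c%:A : A) *: m.
Proof. by []. Qed.

Definition kmap (M N : lmodType A) (f : {linear M -> N}) : kmod M -> kmod N := f.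

Fact kmap_linear (M N : lmodType A) (f : {linear M -> N}) : linear (kmap f).
Proof. by move=> c u v; rewrite /kmap [LHS]linearP. Qed.

HB.instance Definition _ (M N : lmodType A) (f : {linear M -> N}) :=
  GRing.isLinear.Build K (kmod M) (kmod N) _ (kmap f) (kmap_linear f).

(* An A-linear map M -> N^s, seen as a K-linear map M -> N.                   *)
Definition skmap (s : {lrmorphism A -> A}) (M N : lmodType A)
  (f : {linear M -> restr s N}) : kmod M -> kmod N := f.

Fact skmap_linear (s : {lrmorphism A -> A}) (M N : lmodType A) (f : {linear M -> restr s N}) : linear (skmap f).
Proof.
move=> c u v; rewrite /skmap kmodE [LHS]linearP; congr (_ + _).
exact: (congr1 (fun a : A => a *: (f u : N)) (rmorph_alg s c)).
Qed.

HB.instance Definition _ (s : {lrmorphism A -> A}) (M N : lmodType A) (f : {linear M -> restr s N}) :=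
  GRing.isLinear.Build K (kmod M) (kmod N) _ (skmap f) (skmap_linear f).

Definition tact (M : lmodType A) : tens A (kmod M) -> kmod M :=
  tlift (fun (a : A) (m : kmod M) => (a *: (m : M)) : kmod M).

Fact tact_bilin (M : lmodType A) :
  bilin (fun (a : A) (m : kmod M) => (a *: (m : M)) : kmod M).
Proof.
split=> [m c a a'|a c m m'].
  rewrite [LHS](@scalerDl _ M); congr (_ + _).
  by rewrite [RHS]kmodE scalerA mulr_algl.
rewrite [LHS](@scalerDr _ M); congr (_ + _).
by rewrite [RHS]kmodE [X in _ *: X]kmodE !scalerA mulr_algl mulr_algr.
Qed.

HB.instance Definition _ (M : lmodType A) :=
  GRing.isLinear.Build K (tens A (kmod M)) (kmod M) _ (@tact M)
    (tlift_linear (tact_bilin M)).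

Lemma tactE (M : lmodType A) (a : A) (m : M) : tact (a \ot (m : kmod M)) = a *: m.
Proof. exact: tlift_pure (tact_bilin M). Qed.

End Kmod.

Lemma lcomp (K : fieldType) (U V W : lmodType K) (f : V -> W) (g : U -> V) :
  linear f -> linear g -> linear (fun u => f (g u)).
Proof. by move=> lf lg c u v; rewrite lg lf. Qed.

Record twisting_map (K : fieldType) (A B : algType K) := TwistingMap {
  tw_map :> {linear tens B A -> tens A B};
  tw_bij : bijective tw_map;
  tw_1l : forall a, tw_map (1 \ot a) = a \ot 1;
  tw_1r : forall b, tw_map (b \ot 1) = 1 \ot b;
  tw_mul : forall t : tens (tens B B) (tens A A),
    tw_map (tmap (@tmul K B) (@tmul K A) t) =
    tmap (@tmul K A) (@tmul K B)
      (tmid tw_map (tmap tw_map tw_map (tmid tw_map t)))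
}.

(* (m_A \ot m_B) (1 \ot tau \ot 1)                                             *)
Definition twmul (K : fieldType) (A B : algType K)
    (tau : {linear tens B A -> tens A B}) (t u : tens A B) : tens A B :=
  tmap (@tmul K A) (@tmul K B) (tmid tau (t \ot u)).

Section Crossed.
Variables (K : fieldType) (A B : algType K) (tau : {linear tens B A -> tens A B}).

Lemma twmulE a b a' b' : twmul tau (a \ot b) (a' \ot b') =
  tlift (fun c d => (a * c) \ot (d * b')) (tau (b \ot a')).
Proof.
rewrite /twmul tmidE; move: (tau _) => s.
have bl : bilin (fun (c : A) (d : B) => (a * c) \ot (d * b')).
  by split=> [d c e e'|d c e e'] /=;
     rewrite ?mulrDr ?mulrDl -?scalerAr -?scalerAl ?(pureEl, pureEr).
apply: (tens_ext (f := fun s => tmap _ _ (tlift _ s))) s.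
- apply: lcomp; first exact: linearP.
  by apply: tlift_linear; apply: tmid_bilin1.
- exact: tlift_linear bl.
- move=> c d; rewrite (tlift_pure _ _ (tmid_bilin1 _ _ _ _)) (tlift_pure _ _ bl).
  by rewrite tmapE /= !tmulE.
Qed.

Lemma twmul_linearl u : linear (twmul tau ^~ u).
Proof.
apply: (lcomp (f := fun t => tmap _ _ (tmid tau t))).
  by apply: lcomp; apply: linearP.
by move=> c t t'; rewrite pureEl.
Qed.

Lemma twmul_linearr t : linear (twmul tau t).
Proof.
apply: (lcomp (f := fun t => tmap _ _ (tmid tau t))).
  by apply: lcomp; apply: linearP.
by move=> c u u'; rewrite pureEr.
Qed.

Variables (W : lmodType K) (L : A -> W -> W) (T : B -> W -> W).
Hypotheses (bL : bilin L) (bT : bilin T).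
Hypothesis LA : forall a a' w, L (a * a') w = L a (L a' w).
Hypothesis TA : forall b b' w, T (b * b') w = T b (T b' w).
Hypothesis LT : forall b a w,
  T b (L a w) = tlift (fun a' b' => L a' (T b' w)) (tau (b \ot a)).

Fact cross_bilin w : bilin (fun a b => L a (T b w)).
Proof.
split=> [b|a]; first exact: bL.1 (T b w).
exact: lcomp (bL.2 a) (bT.1 w).
Qed.

Fact cross_linearr t : linear (fun w => tlift (fun a b => L a (T b w)) t).
Proof. by apply: tlift_linearl => a b; apply: lcomp (bL.2 a) (bT.2 b). Qed.

Lemma cross_actA t u w :
  tlift (fun a b => L a (T b (tlift (fun a' b' => L a' (T b' w)) u))) t =
  tlift (fun a b => L a (T b w)) (twmul tau t u).
Proof.
have lw := tlift_linear (cross_bilin w).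
move: t; apply: tens_ext; first exact: tlift_linear (cross_bilin _).
  exact: lcomp lw (twmul_linearl u).
move=> a b; rewrite (tlift_pure _ _ (cross_bilin _)); move: u.
apply: (tens_ext (f := fun u => L a (T b (tlift _ u)))).
- exact: lcomp (bL.2 a) (lcomp (bT.2 b) lw).
- exact: lcomp lw (twmul_linearr _).
move=> a' b'; rewrite (tlift_pure _ _ (cross_bilin _)) LT twmulE.
have bl : bilin (fun (c : A) (d : B) => (a * c) \ot (d * b')).
  by split=> [d c e e'|d c e e'] /=;
     rewrite ?mulrDr ?mulrDl -?scalerAr -?scalerAl ?(pureEl, pureEr).
move: (tau _); apply: (tens_ext (f := fun s => L a (tlift _ s))).
- exact: lcomp (bL.2 a) (tlift_linear (cross_bilin _)).
- exact: lcomp lw (tlift_linear bl).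
move=> c d; rewrite (tlift_pure _ _ (cross_bilin _)) (tlift_pure _ _ bl).
by rewrite (tlift_pure _ _ (cross_bilin _)) LA TA.
Qed.

End Crossed.


Section CrossTens.
Variables (K : fieldType) (A B : algType K) (tau : {linear tens B A -> tens A B}).
Variables (V N : lmodType K) (th : {linear tens B V -> tens V B}).
Variables (rho : A -> V -> V) (nu : B -> N -> N).
Hypotheses (brho : bilin rho) (bnu : bilin nu).
Hypothesis rhoA : forall a a' v, rho (a * a') v = rho a (rho a' v).
Hypothesis nuA : forall b b' q, nu (b * b') q = nu b (nu b' q).
Hypothesis rho1 : forall v, rho 1 v = v.
Hypothesis nu1 : forall q, nu 1 q = q.
Hypothesis th1 : forall v, th (1 \ot v) = v \ot 1.
Hypothesis thB : forall (b b' : B) v, th ((b * b') \ot v) =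
  tlift (fun v' d => tlift (fun v'' e => v'' \ot (e * d)) (th (b \ot v')))
    (th (b' \ot v)).
Hypothesis thA : forall b a v, th (b \ot rho a v) =
  tlift (fun c d => tlift (fun v' e => rho c v' \ot e) (th (d \ot v)))
    (tau (b \ot a)).

Let Lb (a : A) : bilin (fun v (q : N) => rho a v \ot q).
Proof.
split=> [q|v] c x y /=; last by rewrite pureEr.
by rewrite (brho.2 a) pureEl.
Qed.

Let Lb' a : bilin (fun v (e : B) => rho a v \ot e).
Proof.
split=> [q|v] c x y /=; last by rewrite pureEr.
by rewrite (brho.2 a) pureEl.
Qed.

Let L a : tens V N -> tens V N := tlift (fun v q => rho a v \ot q).

Let bL : bilin L.
Proof.
split=> [t|a]; last exact: tlift_linear (Lb a).
by apply: tlift_linearl => v q c a a'; rewrite (brho.1 v) pureEl.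
Qed.

Let ab (q : N) : bilin (fun (v : V) b => v \ot nu b q).
Proof.
split=> [b|v] c x y /=; first by rewrite pureEl.
by rewrite (bnu.1 q) pureEr.
Qed.

Let mb (d : B) : bilin (fun (v : V) (e : B) => v \ot (e * d)).
Proof.
split=> [b|v] c x y /=; first by rewrite pureEl.
by rewrite mulrDl -scalerAl pureEr.
Qed.

Let Tb (b : B) : bilin (fun v q => tlift (fun v' b' => v' \ot nu b' q) (th (b \ot v))).
Proof.
split=> [q|v].
  apply: lcomp; first exact: tlift_linear (ab q).
  by move=> c v v'; rewrite pureEr linearP.
by apply: tlift_linearl => v' b' c q q'; rewrite (bnu.2 b') pureEr.
Qed.

Let T b : tens V N -> tens V N :=
  tlift (fun v q => tlift (fun v' b' => v' \ot nu b' q) (th (b \ot v))).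

Let bT : bilin T.
Proof.
split=> [t|b]; last exact: tlift_linear (Tb b).
apply: tlift_linearl => v q; apply: lcomp; first exact: tlift_linear (ab q).
by move=> c b b'; rewrite pureEl linearP.
Qed.

Let LA a a' t : L (a * a') t = L a (L a' t).
Proof.
move: t; apply: tens_ext; first exact: bL.2.
  exact: lcomp (bL.2 a) (bL.2 a').
by move=> v q; rewrite /L !(tlift_pure _ _ (Lb _)) rhoA.
Qed.

Let TA b b' t : T (b * b') t = T b (T b' t).
Proof.
move: t; apply: tens_ext; first exact: bT.2.
  exact: lcomp (bT.2 b) (bT.2 b').
move=> v q; rewrite [LHS](tlift_pure _ _ (Tb _)) [T b' _](tlift_pure _ _ (Tb _)).
rewrite thB; move: (th (b' \ot v)).
have bb : bilin (fun (v' : V) (d : B) =>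
    tlift (fun v'' e => v'' \ot (e * d)) (th (b \ot v'))).
  split=> [d|v'].
    apply: lcomp; first exact: tlift_linear (mb d).
    by move=> c x y; rewrite pureEr linearP.
  by apply: tlift_linearl => x y c d d'; rewrite mulrDr -scalerAr pureEr.
apply: tens_ext.
- by apply: lcomp; [exact: tlift_linear (ab q)|exact: tlift_linear bb].
- by apply: lcomp; [exact: bT.2|exact: tlift_linear (ab q)].
move=> x d; rewrite (tlift_pure _ _ bb) [X in T b X](tlift_pure _ _ (ab q)).
rewrite [RHS](tlift_pure _ _ (Tb _)); move: (th _); apply: tens_ext.
- by apply: lcomp; [exact: tlift_linear (ab q)|exact: tlift_linear (mb d)].
- exact: tlift_linear (ab _).
by move=> y e; rewrite (tlift_pure _ _ (mb d)) !(tlift_pure _ _ (ab _)) nuA.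
Qed.

Let thA_bilin v :
  bilin (fun c d => tlift (fun v' e => rho c v' \ot e) (th (d \ot v))).
Proof.
split=> [d|c].
  by apply: tlift_linearl => v' e k c c'; rewrite (brho.1 v') pureEl.
apply: lcomp; first exact: tlift_linear (Lb' c).
by move=> k d d'; rewrite pureEl linearP.
Qed.

Let LT b a t :
  T b (L a t) = tlift (fun a' b' => L a' (T b' t)) (tau (b \ot a)).
Proof.
move: t; apply: tens_ext; first exact: lcomp (bT.2 b) (bL.2 a).
  exact: cross_linearr bL bT _.
move=> v q; rewrite [L a _](tlift_pure _ _ (Lb a)) [LHS](tlift_pure _ _ (Tb _)).
rewrite thA; move: (tau _); apply: tens_ext.
- by apply: lcomp; [exact: tlift_linear (ab q)|exact: tlift_linear (thA_bilin v)].
- exact: tlift_linear (cross_bilin bL bT _).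
move=> c d; rewrite (tlift_pure _ _ (thA_bilin v)).
rewrite (tlift_pure _ _ (cross_bilin bL bT _)) [T d _](tlift_pure _ _ (Tb _)).
move: (th _); apply: tens_ext.
- by apply: lcomp; [exact: tlift_linear (ab q)|exact: tlift_linear (Lb' c)].
- by apply: lcomp; [exact: bL.2|exact: tlift_linear (ab q)].
move=> v' e; rewrite (tlift_pure _ _ (Lb' c)) !(tlift_pure _ _ (ab q)).
by rewrite [RHS](tlift_pure _ _ (Lb c)).
Qed.

Definition cross_act (t : tens A B) : tens V N -> tens V N := fun w =>
  tlift (fun a b => L a (T b w)) t.

Lemma cross_actE (f : {linear tens A V -> V}) (g : {linear tens B N -> N}) t w :
  (forall a v, f (a \ot v) = rho a v) -> (forall b q, g (b \ot q) = nu b q) ->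
  tmap f g (tmid th (t \ot w)) = cross_act t w.
Proof.
move=> fE gE; move: t.
apply: (tens_ext (f := fun t => tmap f g (tmid th (t \ot w)))).
- apply: (lcomp (f := fun t => tmap _ _ (tmid th t))).
    by apply: lcomp; apply: linearP.
  by move=> c t t'; rewrite pureEl.
- exact: tlift_linear (cross_bilin bL bT w).
move=> a b; rewrite /cross_act (tlift_pure _ _ (cross_bilin bL bT w)).
move: w; apply: (tens_ext (f := fun w => tmap f g (tmid th (a \ot b \ot w)))).
- apply: (lcomp (f := fun t => tmap _ _ (tmid th t))).
    by apply: lcomp; apply: linearP.
  by move=> c t t'; rewrite pureEr.
- exact: lcomp (bL.2 a) (bT.2 b).
move=> v q; rewrite tmidE [T b _](tlift_pure _ _ (Tb b)).
move: (th _); apply: tens_ext.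
- apply: lcomp; first exact: linearP.
  by apply: tlift_linear; apply: tmid_bilin1.
- by apply: lcomp; [exact: bL.2|exact: tlift_linear (ab q)].
move=> v' b'; rewrite tlift_pure ?tmapE ?fE ?gE; last exact: tmid_bilin1.
by rewrite (tlift_pure _ _ (ab q)) [RHS](tlift_pure _ _ (Lb a)).
Qed.

Lemma cross_mod_linearl w : linear (cross_act ^~ w).
Proof. exact: tlift_linear (cross_bilin bL bT w). Qed.

Lemma cross_mod_linearr t : linear (cross_act t).
Proof. exact: cross_linearr bL bT t. Qed.

Lemma cross_modA t u w :
  cross_act t (cross_act u w) = cross_act (twmul tau t u) w.
Proof. exact: (cross_actA bL bT LA TA LT). Qed.

Lemma cross_mod1 w : cross_act (1 \ot 1) w = w.
Proof.
move: w; apply: tens_ext; [exact: cross_mod_linearr|by []|].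
move=> v q; rewrite /cross_act (tlift_pure _ _ (cross_bilin bL bT _)).
rewrite [T 1 _](tlift_pure _ _ (Tb 1)) th1 (tlift_pure _ _ (ab q)).
by rewrite [LHS](tlift_pure _ _ (Lb 1)) rho1 nu1.
Qed.

End CrossTens.

Section TwistingCriterion.
Variables (K : fieldType) (A B : algType K) (tau : {linear tens B A -> tens A B}).
Hypothesis tau1l : forall a, tau (1 \ot a) = a \ot 1.
Hypothesis tau1r : forall b, tau (b \ot 1) = 1 \ot b.
Hypothesis tauB : forall (b b' : B) a, tau ((b * b') \ot a) =
  tlift (fun v' d => tlift (fun v'' e => v'' \ot (e * d)) (tau (b \ot v')))
    (tau (b' \ot a)).
Hypothesis tauA : forall b (a v : A), tau (b \ot (a * v)) =
  tlift (fun c d => tlift (fun v' e => (c * v') \ot e) (tau (d \ot v)))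
    (tau (b \ot a)).

Lemma twmul_cross t u : twmul tau t u = cross_act tau *%R *%R t u.
Proof.
apply: cross_actE; try exact: tmul_bilin; exact: tmulE.
Qed.

Lemma twmulA_crit : associative (twmul tau).
Proof.
move=> t u v; rewrite [twmul tau u v]twmul_cross !twmul_cross.
rewrite (cross_modA (tmul_bilin A) (tmul_bilin B) _ _ tauB tauA) ?twmul_cross //;
by move=> *; rewrite mulrA.
Qed.

Lemma twmul1l_crit : left_id (1 \ot 1) (twmul tau).
Proof.
move=> t; rewrite twmul_cross (cross_mod1 (tmul_bilin A) (tmul_bilin B)) //.
- exact: mul1r.
- exact: mul1r.
Qed.

Lemma tens_id_bilin (U V : lmodType K) : tlift (@pure K U V) =1 id.
Proof.
apply: tens_ext; [exact: tlift_linear (bilin_pure U V)|by []|].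
by move=> u v; rewrite tlift_pure //; apply: bilin_pure.
Qed.

Lemma twmul1r_crit : right_id (1 \ot 1) (twmul tau).
Proof.
apply: tens_ext => [||a b]; [exact: twmul_linearl|by []|].
rewrite twmulE tau1r tlift_pure ?mulr1 ?mul1r //.
by split=> [d|d] c e e' /=;
  rewrite ?mulrDr ?mulrDl -?scalerAr -?scalerAl ?(pureEl, pureEr).
Qed.

Lemma twmul_BA b a : twmul tau (1 \ot b) (a \ot 1) = tau (b \ot a).
Proof.
rewrite twmulE -[RHS]tens_id_bilin; congr (tlift _ _).
by apply/funext => c; apply/funext => d; rewrite mul1r mulr1.
Qed.

Lemma tw_bl (a : A) (b : B) : bilin (fun (c : A) (d : B) => (a * c) \ot (d * b)).
Proof.
by split=> [d|d] c e e' /=;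
  rewrite ?mulrDr ?mulrDl -?scalerAr -?scalerAl ?(pureEl, pureEr).
Qed.

Lemma twmul_AB a b : twmul tau (a \ot 1) (1 \ot b) = a \ot b.
Proof. by rewrite twmulE tau1l (tlift_pure _ _ (tw_bl _ _)) mulr1 mul1r. Qed.

Lemma twmul_AA a a' : twmul tau (a \ot 1) (a' \ot 1) = (a * a') \ot 1.
Proof. by rewrite twmulE tau1l (tlift_pure _ _ (tw_bl _ _)) mul1r. Qed.

Lemma twmul_BB b b' : twmul tau (1 \ot b) (1 \ot b') = 1 \ot (b * b').
Proof. by rewrite twmulE tau1r (tlift_pure _ _ (tw_bl _ _)) mul1r. Qed.

Lemma tw_mul_crit (t : tens (tens B B) (tens A A)) :
  tau (tmap (@tmul K B) (@tmul K A) t) =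
  tmap (@tmul K A) (@tmul K B) (tmid tau (tmap tau tau (tmid tau t))).
Proof.
move: t; apply: (tens_ext (f := fun t => tau (tmap _ _ t))).
- by apply: lcomp; apply: linearP.
- apply: lcomp; first exact: linearP.
  apply: lcomp; first exact: linearP.
  apply: (lcomp (f := tmap tau tau)); exact: linearP.
move=> t u; move: t; apply: (tens_ext (f := fun t => tau (tmap _ _ (t \ot u)))).
- apply: (lcomp (f := fun t => tau (tmap _ _ t))).
    by apply: lcomp; apply: linearP.
  by move=> c x y; rewrite pureEl.
- apply: (lcomp (f := fun t => tmap _ _ (tmid tau (tmap tau tau (tmid tau t))))).
    apply: lcomp; first exact: linearP.
    apply: lcomp; first exact: linearP.
    apply: (lcomp (f := tmap tau tau)); exact: linearP.
  by move=> c x y; rewrite pureEl.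
move=> b b'; move: u.
apply: (tens_ext (f := fun u => tau (tmap _ _ (b \ot b' \ot u)))).
- apply: (lcomp (f := fun t => tau (tmap _ _ t))).
    by apply: lcomp; apply: linearP.
  by move=> c x y; rewrite pureEr.
- apply: (lcomp (f := fun t => tmap _ _ (tmid tau (tmap tau tau (tmid tau t))))).
    apply: lcomp; first exact: linearP.
    apply: lcomp; first exact: linearP.
    apply: (lcomp (f := tmap tau tau)); exact: linearP.
  by move=> c x y; rewrite pureEr.
move=> a a'; rewrite tmapE /= !tmulE -twmul_BA -twmul_BB -twmul_AA.
rewrite -twmulA_crit [X in twmul _ _ X]twmulA_crit twmul_BA tmidE.
move: (tau (b' \ot a)).
have bl : bilin (fun (w' : A) (v' : B) => (b \ot w') \ot (v' \ot a')).
  exact: tmid_bilin1.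
apply: tens_ext.
- apply: (lcomp (f := twmul tau _)); first exact: twmul_linearr.
  exact: twmul_linearl.
- apply: lcomp; first exact: linearP.
  apply: lcomp; first exact: linearP.
  apply: (lcomp (f := tmap tau tau)); first exact: linearP.
  exact: tlift_linear bl.
move=> c d; rewrite (tlift_pure _ _ bl) tmapE -[RHS]/(twmul tau _ _).
by rewrite -!twmul_BA twmulA_crit -[c \ot d]twmul_AB !twmulA_crit.
Qed.

End TwistingCriterion.

Section TwistingTheory.
Variables (K : fieldType) (A B : algType K) (tau : twisting_map A B).

Lemma tw_mulB (b b' : B) a : tau ((b * b') \ot a) =
  tlift (fun v' d => tlift (fun v'' e => v'' \ot (e * d)) (tau (b \ot v')))
    (tau (b' \ot a)).
Proof.
have := tw_mul tau ((b \ot b') \ot (a \ot 1)).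
rewrite tmapE /= !tmulE mulr1 => ->; rewrite tmidE.
have b1 : bilin (fun (w' : A) (v' : B) => (b \ot w') \ot (v' \ot (1 : A))).
  exact: tmid_bilin1.
have b2 (d : B) : bilin (fun (v : A) e => v \ot (e * d)).
  split=> [x|v] c y z /=; first by rewrite pureEl.
  by rewrite mulrDl -scalerAl pureEr.
have b3 : bilin (fun (v' : A) (d : B) =>
    tlift (fun v'' e => v'' \ot (e * d)) (tau (b \ot v'))).
  split=> [d|v'].
    apply: lcomp; first exact: tlift_linear (b2 d).
    by move=> c x y; rewrite pureEr linearP.
  by apply: tlift_linearl => x y c d d'; rewrite mulrDr -scalerAr pureEr.
move: (tau (b' \ot a)); apply: tens_ext.
- apply: lcomp; first exact: linearP.
  apply: lcomp; first exact: linearP.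
  apply: (lcomp (f := tmap tau tau)); first exact: linearP.
  exact: tlift_linear b1.
- exact: tlift_linear b3.
move=> c d; rewrite (tlift_pure _ _ b1) (tlift_pure _ _ b3) tmapE tw_1r.
move: (tau _); apply: (tens_ext (f := fun s => tmap _ _ (tmid tau (s \ot _)))).
- apply: (lcomp (f := fun s => tmap _ _ (tmid tau s))).
    by apply: lcomp; apply: linearP.
  by move=> k x y; rewrite pureEl.
- exact: tlift_linear (b2 d).
move=> x y; rewrite -[LHS]/(twmul tau _ _) twmulE tw_1r.
by rewrite (tlift_pure _ _ (tw_bl _ _)) mulr1 (tlift_pure _ _ (b2 d)).
Qed.

Lemma tw_mulA b (a v : A) : tau (b \ot (a * v)) =
  tlift (fun c d => tlift (fun v' e => (c * v') \ot e) (tau (d \ot v)))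
    (tau (b \ot a)).
Proof.
have := tw_mul tau ((1 \ot b) \ot (a \ot v)).
rewrite tmapE /= !tmulE mul1r => ->; rewrite tmidE.
have b1 : bilin (fun (w' : A) (v' : B) => ((1 : B) \ot w') \ot (v' \ot v)).
  exact: tmid_bilin1.
have b2 (c : A) : bilin (fun (x : A) (e : B) => (c * x) \ot e).
  split=> [x|x] k y z /=; last by rewrite pureEr.
  by rewrite mulrDr -scalerAr pureEl.
have b3 : bilin (fun (c : A) (d : B) =>
    tlift (fun v' (e : B) => (c * v') \ot e) (tau (d \ot v))).
  split=> [d|c].
    by apply: tlift_linearl => x y k c c'; rewrite mulrDl -scalerAl pureEl.
  apply: lcomp; first exact: tlift_linear (b2 c).
  by move=> k x y; rewrite pureEl linearP.
move: (tau (b \ot a)); apply: tens_ext.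
- apply: lcomp; first exact: linearP.
  apply: lcomp; first exact: linearP.
  apply: (lcomp (f := tmap tau tau)); first exact: linearP.
  exact: tlift_linear b1.
- exact: tlift_linear b3.
move=> c d; rewrite (tlift_pure _ _ b1) (tlift_pure _ _ b3) tmapE tw_1l.
move: (tau _); apply: (tens_ext (f := fun s => tmap _ _ (tmid tau (_ \ot s)))).
- apply: (lcomp (f := fun s => tmap _ _ (tmid tau s))).
    by apply: lcomp; apply: linearP.
  by move=> k x y; rewrite pureEr.
- exact: tlift_linear (b2 c).
move=> x y; rewrite -[LHS]/(twmul tau _ _) twmulE tw_1l.
by rewrite (tlift_pure _ _ (tw_bl _ _)) mul1r (tlift_pure _ _ (b2 c)).
Qed.

End TwistingTheory.

(* The twisted tensor product algebra: the vector space A \ot B, whose         *)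
(* multiplication (below) depends on tau.                                     *)
Definition twtens (K : fieldType) (A B : algType K) (tau : twisting_map A B) : Type :=
  tens A B.

Section TwistedAlgebra.
Variables (K : fieldType) (A B : algType K) (tau : twisting_map A B).
Local Notation twtens := (twtens tau).

HB.instance Definition _ := GRing.Lmodule.copy twtens (tens A B).

Let mul (t u : twtens) : twtens := twmul tau t u.

Fact twtens_mulA : associative mul.
Proof. by apply: twmulA_crit; [exact: tw_mulB|exact: tw_mulA]. Qed.
Fact twtens_mul1r : left_id (1 \ot 1 : twtens) mul.
Proof. exact: twmul1l_crit (tw_1l tau). Qed.
Fact twtens_mulr1 : right_id (1 \ot 1 : twtens) mul.
Proof. exact: twmul1r_crit (tw_1r tau). Qed.
Fact twtens_mulDl : left_distributive mul +%R.
Proof.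
move=> t u v; have := twmul_linearl tau v 1 t u.
by rewrite !scale1r.
Qed.
Fact twtens_mulDr : right_distributive mul +%R.
Proof.
move=> v t u; have := twmul_linearr tau v 1 t u.
by rewrite !scale1r.
Qed.

HB.instance Definition _ := GRing.Zmodule_isPzRing.Build twtens
  twtens_mulA twtens_mul1r twtens_mulr1 twtens_mulDl twtens_mulDr.

Definition inA (a : A) : twtens := a \ot 1.
Definition inB (b : B) : twtens := 1 \ot b.

Fact inA_zmod : zmod_morphism inA.
Proof.
move=> a a'; rewrite /inA -!scaleN1r addrC pureEl addrC.
by [].
Qed.
Fact inA_monoid : monoid_morphism inA.
Proof. by split=> // a a'; rewrite [RHS]twmul_AA //; apply: tw_1l. Qed.

HB.instance Definition _ := GRing.isZmodMorphism.Build A twtens inA inA_zmod.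
HB.instance Definition _ := GRing.isMonoidMorphism.Build A twtens inA inA_monoid.

Lemma inBM : {morph inB : b b' / b * b'}.
Proof. by move=> b b'; rewrite [RHS]twmul_BB //; apply: tw_1r. Qed.

Lemma inA_inB a b : inA a * inB b = a \ot b.
Proof. by rewrite [LHS]twmul_AB //; apply: tw_1l. Qed.

Lemma inB_inA a b : inB b * inA a = tau (b \ot a).
Proof. exact: twmul_BA. Qed.

End TwistedAlgebra.

(* Associators are explicit in the two conditions.                            *)
Record compatible (K : fieldType) (A B : algType K)
    (tau : {linear tens B A -> tens A B}) (M : lmodType A)
    (th : {linear tens B (kmod M) -> tens (kmod M) B}) : Prop := Compatible {
  compat_bij : bijective th;
  compat_mul : forall t : tens (tens B B) (kmod M),
    th (tmap (@tmul K B) (@idfun (kmod M)) t) =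
    tmap (@idfun (kmod M)) (@tmul K B) (tassoc
      (tmap th (@idfun B) (tassocV (tmap (@idfun B) th (tassoc t)))));
  compat_act : forall t : tens B (tens A (kmod M)),
    th (tmap (@idfun B) (@tact K A M) t) =
    tmap (@tact K A M) (@idfun B) (tassocV
      (tmap (@idfun A) th (tassoc (tmap tau (@idfun (kmod M)) (tassocV t)))))
}.

(* M \ot N as a module over A \ot_tau B, acting by                             *)
(* (rho_{A,M} \ot rho_{B,N}) (1 \ot th \ot 1), see [twact].                     *)
Definition twmod (K : fieldType) (A B : algType K) (tau : twisting_map A B)
  (M : lmodType A) (th : {linear tens B (kmod M) -> tens (kmod M) B})
  (cM : compatible tau th) (N : lmodType B) : Type := tens (kmod M) (kmod N).

Section TwistedModule.
Variables (K : fieldType) (A B : algType K) (tau : twisting_map A B).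
Variables (M : lmodType A) (th : {linear tens B (kmod M) -> tens (kmod M) B}).
Hypothesis cM : compatible tau th.

Lemma compatB (b b' : B) v : th ((b * b') \ot v) =
  tlift (fun v' d => tlift (fun v'' e => v'' \ot (e * d)) (th (b \ot v')))
    (th (b' \ot v)).
Proof.
have := compat_mul cM (b \ot b' \ot v); rewrite tmapE /= tmulE => ->.
rewrite tassocE tmapE.
have b2 (d : B) : bilin (fun (v : kmod M) e => v \ot (e * d)).
  split=> [x|u] c y z /=; first by rewrite pureEl.
  by rewrite mulrDl -scalerAl pureEr.
have b3 : bilin (fun (v' : kmod M) (d : B) =>
    tlift (fun v'' e => v'' \ot (e * d)) (th (b \ot v'))).
  split=> [d|v'].
    apply: lcomp; first exact: tlift_linear (b2 d).
    by move=> c x y; rewrite pureEr linearP.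
  by apply: tlift_linearl => x y c d d'; rewrite mulrDr -scalerAr pureEr.
move: (th (b' \ot v)).
apply: (tens_ext (f := fun s => tmap _ _ (tassoc (tmap _ _ (tassocV (_ \ot s)))))).
- apply: (lcomp (f := fun s => tmap _ _ (tassoc (tmap _ _ (tassocV s))))).
    apply: lcomp; first exact: linearP.
    apply: lcomp; first exact: linearP.
    by apply: lcomp; apply: linearP.
  by move=> c x y; rewrite pureEr.
- exact: tlift_linear b3.
move=> v' d; rewrite tassocVE tmapE /= (tlift_pure _ _ b3); move: (th _).
apply: (tens_ext (f := fun s => tmap _ _ (tassoc (s \ot _)))).
- apply: (lcomp (f := fun s => tmap _ _ (tassoc s))).
    by apply: lcomp; apply: linearP.
  by move=> c x y; rewrite pureEl.
- exact: tlift_linear (b2 d).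
by move=> x e; rewrite tassocE tmapE /= tmulE (tlift_pure _ _ (b2 d)).
Qed.

Lemma compatA b a (v : kmod M) : th (b \ot (a *: (v : M) : kmod M)) =
  tlift (fun c d => tlift (fun (v' : kmod M) e => (c *: (v' : M) : kmod M) \ot e)
    (th (d \ot v))) (tau (b \ot a)).
Proof.
have := compat_act cM (b \ot (a \ot v)); rewrite tmapE /= tactE => ->.
rewrite tassocVE tmapE.
have b2 (c : A) : bilin (fun (x : kmod M) (e : B) => (c *: (x : M) : kmod M) \ot e).
  split=> [x|x] k y z /=; last by rewrite pureEr.
  by rewrite ((tact_bilin M).2 c) pureEl.
have b3 : bilin (fun (c : A) (d : B) =>
    tlift (fun (v' : kmod M) (e : B) => (c *: (v' : M) : kmod M) \ot e)
     (th (d \ot v))).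
  split=> [d|c].
    by apply: tlift_linearl => x y k c c'; rewrite ((tact_bilin M).1 x) pureEl.
  apply: lcomp; first exact: tlift_linear (b2 c).
  by move=> k x y; rewrite pureEl linearP.
move: (tau _).
apply: (tens_ext (f := fun s => tmap _ _ (tassocV (tmap _ _ (tassoc (s \ot _)))))).
- apply: (lcomp (f := fun s => tmap _ _ (tassocV (tmap _ _ (tassoc s))))).
    apply: lcomp; first exact: linearP.
    apply: lcomp; first exact: linearP.
    by apply: lcomp; apply: linearP.
  by move=> c x y; rewrite pureEl.
- exact: tlift_linear b3.
move=> c d; rewrite tassocE tmapE /= (tlift_pure _ _ b3); move: (th _).
apply: (tens_ext (f := fun s => tmap _ _ (tassocV (_ \ot s)))).
- apply: (lcomp (f := fun s => tmap _ _ (tassocV s))).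
    by apply: lcomp; apply: linearP.
  by move=> k x y; rewrite pureEr.
- exact: tlift_linear (b2 c).
by move=> x e; rewrite tassocVE tmapE /= tactE (tlift_pure _ _ (b2 c)).
Qed.

Lemma compat1 v : th (1 \ot v) = v \ot 1.
Proof.
have b2 (d : B) : bilin (fun (v : kmod M) e => v \ot (e * d)).
  split=> [x|u] c y z /=; first by rewrite pureEl.
  by rewrite mulrDl -scalerAl pureEr.
have b3 : bilin (fun (v' : kmod M) (d : B) =>
    tlift (fun v'' e => v'' \ot (e * d)) (th (1 \ot v'))).
  split=> [d|v'].
    apply: lcomp; first exact: tlift_linear (b2 d).
    by move=> c x y; rewrite pureEr linearP.
  by apply: tlift_linearl => x y c d d'; rewrite mulrDr -scalerAr pureEr.
have T1 s : tlift (fun (v' : kmod M) (d : B) =>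
    tlift (fun v'' e => v'' \ot (e * d)) (th (1 \ot v'))) s = s.
  have [g _ gK] := compat_bij cM; rewrite -(gK s); move: (g s).
  apply: (tens_ext (f := fun s => tlift _ (th s))).
  - by apply: lcomp; [exact: tlift_linear b3|exact: linearP].
  - exact: linearP.
  by move=> b u; rewrite -compatB mul1r.
have := T1 (v \ot 1); rewrite (tlift_pure _ _ b3) => <-.
rewrite -[LHS]tens_id_bilin; congr (tlift _ _).
by apply/funext => c; apply/funext => d; rewrite mulr1.
Qed.

Variable N : lmodType B.

HB.instance Definition _ := GRing.Zmodule.copy (twmod cM N) (tens (kmod M) (kmod N)).

Definition twact (t : twtens tau) (w : twmod cM N) : twmod cM N :=
  tmap (@tact K A M) (@tact K B N) (tmid th (t \ot w)).

Let rho (a : A) (v : kmod M) : kmod M := a *: (v : M).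
Let nu (b : B) (q : kmod N) : kmod N := b *: (q : N).

Let twactE t w : twact t w = cross_act th rho nu t w.
Proof.
apply: cross_actE; [exact: tact_bilin|exact: tact_bilin| |] => *; exact: tactE.
Qed.

Fact twact_A a b v : twact a (twact b v) = twact (a * b) v.
Proof.
rewrite !twactE; apply: cross_modA.
- exact: tact_bilin.
- exact: tact_bilin.
- by move=> *; rewrite /rho scalerA.
- by move=> *; rewrite /nu scalerA.
- exact: compatB.
- exact: compatA.
Qed.
Fact twact_1 : left_id 1 twact.
Proof.
move=> w; rewrite twactE; apply: cross_mod1.
- exact: tact_bilin.
- exact: tact_bilin.
- by move=> v; apply: (@scale1r A M).
- by move=> v; apply: (@scale1r B N).
- exact: compat1.
Qed.
Fact twact_Dr : right_distributive twact +%R.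
Proof.
move=> t w w'; have h : linear (cross_act th rho nu t).
  by apply: cross_mod_linearr; apply: tact_bilin.
by have := h 1 w w'; rewrite !scale1r !twactE.
Qed.
Fact twact_Dl w : {morph twact^~ w : a b / a + b}.
Proof.
move=> t t'; have h : linear (fun t => cross_act th rho nu t w).
  by apply: cross_mod_linearl; apply: tact_bilin.
by have := h 1 t t'; rewrite !scale1r !twactE.
Qed.

HB.instance Definition _ := GRing.Zmodule_isLmodule.Build (twtens tau) (twmod cM N)
  twact_A twact_1 twact_Dr twact_Dl.

End TwistedModule.

(* {poly %/ p} silently replaces a constant p by 'X, so that tpoly K 0 is not *)
(* the zero ring; only n > 1 is used.                                         *)
Definition tpoly (K : fieldType) (n : nat) : comUnitAlgType K :=
  {poly %/ ('X^n : {poly K})}.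

Definition xbar (K : fieldType) (n : nat) : tpoly K n := 'qX.

Definition tcoef (K : fieldType) (n : nat) (b : tpoly K n) (i : nat) : K :=
  (b : {poly %/ ('X^n : {poly K})}) `_ i.

Section TPoly.
Variables (K : fieldType) (n : nat).
Local Notation B := (tpoly K n).
Local Notation x := (xbar K n : B).

Lemma tcoef_linear i c (b b' : B) :
  tcoef (c *: b + b') i = c * tcoef b i + tcoef b' i.
Proof. by rewrite /tcoef /= coefD coefZ. Qed.

Hypothesis n_gt0 : (0 < n)%N.

Let inq (p : {poly K}) : B := in_qpoly 'X^n p.

Let inq_small (p : {poly K}) : (size p <= n)%N ->
  (inq p : {poly %/ ('X^n : {poly K})}) = p :> {poly K}.
Proof.
move=> sp; apply: (@in_qpoly_small K).
by rewrite (@mk_monic_Xn K) size_polyXn prednK.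
Qed.

Let inq_x k : x ^+ k = inq 'X^k.
Proof. exact/esym/(rmorphXn (@in_qpoly K 'X^n)). Qed.

Lemma tpoly_xn : x ^+ n = 0.
Proof.
rewrite inq_x; apply: val_inj => /=.
by rewrite mk_monic_Xn prednK // Pdiv.RingMonic.rmodpp ?monicXn.
Qed.

Lemma tcoefX k i : (k < n)%N -> tcoef (x ^+ k) i = (i == k)%:R.
Proof.
by move=> kn; rewrite /tcoef inq_x inq_small ?coefXn // size_polyXn.
Qed.

Lemma tpoly_sum (b : B) : b = \sum_(k < n) tcoef b k *: x ^+ k.
Proof.
have sb : (size (b : {poly %/ ('X^n : {poly K})}) <= n)%N.
  rewrite -ltnS; apply: leq_trans (@size_mk_monic K 'X^n b) _.
  by rewrite (@mk_monic_Xn K) size_polyXn prednK.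
have eb : b = inq (\poly_(k < n) tcoef b k).
  apply: val_inj; rewrite [RHS]inq_small ?size_poly //.
  apply/polyP => i; rewrite coef_poly; case: ltnP => // h.
  by rewrite nth_default // (leq_trans sb).
rewrite {1}eb poly_def [LHS](raddf_sum (@in_qpoly K 'X^n)); apply: eq_bigr => k _ /=.
by rewrite inq_x; exact: (@in_qpolyZ K).
Qed.

End TPoly.

(* Composition of the word w in two letters, [true] standing for f and        *)
(* [false] for g.                                                             *)
Definition wcomp (V : Type) (f g : V -> V) (w : seq bool) (v : V) : V :=
  foldr (fun c : bool => if c then f else g) v w.

(* Sum of the 'C(i + j, i) compositions of i copies of f and j copies of g.   *)
Definition scomp (V : nmodType) (i j : nat) (f g : V -> V) (v : V) : V :=
  \sum_(w : (i + j).-tuple bool | count id w == i) wcomp f g w v.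

(* The linear map x^k \ot v |-> \sum_(i + j = k) s_(i, j)(f, g)(v) \ot x^i,    *)
(* for k < n, obtained by iterating x \ot v |-> f v \ot x + g v \ot 1.         *)
Definition ore_twist (K : fieldType) (n : nat) (V : lmodType K)
    (f g : {linear V -> V}) : tens (tpoly K n) V -> tens V (tpoly K n) :=
  tlift (fun (b : tpoly K n) (v : V) => \sum_(k < n) \sum_(i < k.+1)
    tcoef b k *: (scomp i (k - i) f g v \ot xbar K n ^+ i)).

Section OreTwist.
Variables (K : fieldType) (n : nat) (V : lmodType K) (f g : {linear V -> V}).
Local Notation B := (tpoly K n).
Local Notation x := (xbar K n : B).

Lemma wcomp_linear w : linear (wcomp f g w).
Proof. by elim: w => [|c w ih] k u v //=; rewrite ih; case: c; rewrite linearP. Qed.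

Lemma scomp_linear i j : linear (scomp i j f g).
Proof.
move=> k u v; rewrite /scomp scaler_sumr -big_split; apply: eq_bigr => w _.
exact: wcomp_linear.
Qed.

Fact ore_twist_bilin : bilin (fun (b : B) (v : V) =>
  \sum_(k < n) \sum_(i < k.+1)
    tcoef b k *: (scomp i (k - i) f g v \ot x ^+ i)).
Proof.
split=> [v|b] c y z /=; rewrite scaler_sumr -big_split; apply: eq_bigr => k _;
  rewrite scaler_sumr -big_split; apply: eq_bigr => i _ /=.
  by rewrite tcoef_linear scalerDl scalerA.
by rewrite scomp_linear pureEl scalerDr !scalerA mulrC.
Qed.

HB.instance Definition _ := GRing.isLinear.Build K (tens B V) (tens V B) _
  (@ore_twist K n V f g) (tlift_linear ore_twist_bilin).

Definition ore_step : tens V B -> tens V B :=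
  tlift (fun v b => f v \ot (x * b) + g v \ot b).

Fact ore_step_bilin : bilin (fun v (b : B) => f v \ot (x * b) + g v \ot b).
Proof.
split=> [b|v] c y z /=; rewrite scalerDr addrACA.
  by rewrite !linearP !pureEl.
by rewrite mulrDr -scalerAr !pureEr.
Qed.

HB.instance Definition _ := GRing.isLinear.Build K (tens V B) (tens V B) _
  ore_step (tlift_linear ore_step_bilin).

Lemma ore_stepE v b : ore_step (v \ot b) = f v \ot (x * b) + g v \ot b.
Proof. exact: tlift_pure ore_step_bilin. Qed.

Lemma big_tupleS (W : nmodType) k (F : seq bool -> W) :
  \sum_(w : k.+1.-tuple bool) F w =
  \sum_(w : k.-tuple bool) (F (true :: w) + F (false :: w)).
Proof.
rewrite (reindex (fun p : bool * k.-tuple bool => [tuple of p.1 :: p.2])) /=.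
  rewrite -(pair_bigA _ (fun c (w : k.-tuple bool) => F (c :: w))) /= big_split /=.
  by rewrite big_bool.
exists (fun w => (thead w, [tuple of behead w])) => [[c w] _|w _] /=.
  by congr pair; apply: val_inj.
by rewrite [RHS]tuple_eta.
Qed.

Lemma iter_ore_step k v : iter k ore_step (v \ot 1) =
  \sum_(w : k.-tuple bool) wcomp f g w v \ot x ^+ count id w.
Proof.
elim: k => [|k ih] /=.
  by rewrite (big_pred1 [tuple]) // => w; rewrite [w]tuple0 /= eqxx.
rewrite ih linear_sum (big_tupleS k (fun w => wcomp f g w v \ot x ^+ count id w)).
by apply: eq_bigr => w _; rewrite [LHS]ore_stepE /= add0n add1n exprS.
Qed.

Lemma sum_scomp k v : \sum_(i < k.+1) scomp i (k - i) f g v \ot x ^+ i =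
  iter k ore_step (v \ot 1).
Proof.
rewrite iter_ore_step.
rewrite (partition_big (fun w : k.-tuple bool => inord (count id w) : 'I_k.+1)
  xpredT) //=.
apply: eq_bigr => i _; rewrite /scomp.
have eq m : (i + (k - i) = m)%N ->
    \sum_(w : (i + (k - i)).-tuple bool | count id w == i) wcomp f g w v =
    \sum_(w : m.-tuple bool | count id w == i) wcomp f g w v by move->.
rewrite (eq k) ?subnKC -1?ltnS //.
have -> : forall (P : pred (k.-tuple bool)) (F : k.-tuple bool -> V) (b : B),
  (\sum_(w | P w) F w) \ot b = \sum_(w | P w) F w \ot b.
  move=> P F b; apply: (big_morph (fun u => u \ot b)) => [u u'|].
    by have := pureEl 1 u u' b; rewrite !scale1r.
  exact: (bilin0 b (bilin_pure V B)).
have cle (w : k.-tuple bool) : (count id w < k.+1)%N.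
  by rewrite ltnS -[X in (_ <= X)%N](size_tuple w) count_size.
apply: eq_big => [w|w /eqP -> //]; rewrite -val_eqE /= inordK //.
Qed.

Lemma ore_twistE b v : ore_twist f g (b \ot v) =
  \sum_(k < n) tcoef b k *: iter k ore_step (v \ot 1).
Proof.
rewrite [LHS](tlift_pure _ _ ore_twist_bilin); apply: eq_bigr => k _.
by rewrite -sum_scomp scaler_sumr.
Qed.

Hypothesis n_gt0 : (0 < n)%N.

Lemma ore_twistX k v : (k < n)%N ->
  ore_twist f g (x ^+ k \ot v) = iter k ore_step (v \ot 1).
Proof.
move=> kn; rewrite ore_twistE (bigD1 (Ordinal kn)) //= tcoefX // eqxx scale1r.
rewrite big1 ?addr0 // => i; rewrite -val_eqE /= => /negPf ne.
by rewrite tcoefX // ne scale0r.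
Qed.

Lemma ore_twist1 v : ore_twist f g ((1 : B) \ot v) = v \ot 1.
Proof. by rewrite -(expr0 x) ore_twistX. Qed.

Hypothesis s0 :
  forall i j, (i + j)%N = n -> (0 < j)%N -> forall v, scomp i j f g v = 0.

Lemma ore_step_nil v : iter n ore_step (v \ot 1) = 0.
Proof.
rewrite -sum_scomp big1 // => i _; have [lt|] := ltnP i n.
  rewrite s0 ?subn_gt0 // ?subnKC //; last exact: ltnW.
  exact: (bilin0 _ (bilin_pure V B)).
move=> le; have -> : (i : nat) = n.
  by apply/eqP; rewrite eqn_leq le -ltnS ltn_ord.
rewrite tpoly_xn //; have := pureEr (-1) (scomp n (n - n) f g v) (0 : B) 0.
by rewrite scaler0 addr0 scaleN1r addNr.
Qed.

Lemma ore_twistMX b v : ore_twist f g ((x * b) \ot v) = ore_step (ore_twist f g (b \ot v)).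
Proof.
have bl := bilin_pure B V.
have lb : linear (fun b : B => ore_twist f g ((x * b) \ot v)).
  by move=> c y z; rewrite mulrDr -scalerAr pureEl linearP.
have lb' : linear (fun b : B => ore_step (ore_twist f g (b \ot v))).
  by move=> c y z; rewrite pureEl !linearP.
pose F : {linear B -> tens V B} := HB.pack (fun b : B => ore_twist f g ((x * b) \ot v))
  (GRing.isLinear.Build K B (tens V B) _ _ lb).
pose G : {linear B -> tens V B} := HB.pack (fun b : B => ore_step (ore_twist f g (b \ot v)))
  (GRing.isLinear.Build K B (tens V B) _ _ lb').
suff : F b = G b by [].
rewrite (tpoly_sum n_gt0 b) !linear_sum; apply: eq_bigr => k _.
rewrite !linearZ; congr (_ *: _); rewrite /= -exprS [in RHS]ore_twistX //.
have [lt|] := ltnP k.+1 n; first by rewrite ore_twistX.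
move=> le; have -> : k.+1 = n by apply/eqP; rewrite eqn_leq ltn_ord le.
rewrite tpoly_xn // (bilin0 _ bl) linear0.
have -> : ore_step (iter k ore_step (v \ot 1)) = iter k.+1 ore_step (v \ot 1) by [].
have -> : k.+1 = n by apply/eqP; rewrite eqn_leq ltn_ord le.
by rewrite ore_step_nil.
Qed.

End OreTwist.

Section OreTwistMul.
Variables (K : fieldType) (n : nat) (V : lmodType K) (f g : {linear V -> V}).
Local Notation B := (tpoly K n).
Local Notation x := (xbar K n : B).
Hypothesis n_gt0 : (0 < n)%N.
Hypothesis s0 :
  forall i j, (i + j)%N = n -> (0 < j)%N -> forall v, scomp i j f g v = 0.

Local Notation th := (ore_twist f g : tens B V -> tens V B).
Local Notation step := (ore_step f g : tens V B -> tens V B).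

Lemma iter_linear k : linear (iter k step).
Proof. by elim: k => [|k ih] c u v //=; rewrite ih linearP. Qed.

Lemma rmul_bilin (W : lmodType K) (d : B) :
  bilin (fun (v : W) (e : B) => v \ot (e * d)).
Proof.
split=> [y|u] c y' z /=; first by rewrite pureEl.
by rewrite mulrDl -scalerAl pureEr.
Qed.

Lemma rmul_step (d : B) k (t : tens V B) :
  tlift (fun v (e : B) => v \ot (e * d)) (iter k step t) =
  iter k step (tlift (fun v (e : B) => v \ot (e * d)) t).
Proof.
have lR := tlift_linear (rmul_bilin V d).
elim: k => //= k <-; move: (iter k _ _); apply: tens_ext.
- by apply: (lcomp lR); apply: linearP.
- by apply: (lcomp (f := step)); first exact: linearP.
move=> v e; rewrite (tlift_pure _ _ (rmul_bilin V d)) !ore_stepE.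
have := lR 1 (f v \ot (x * e)) (g v \ot e); rewrite !scale1r => ->.
by rewrite !(tlift_pure _ _ (rmul_bilin V d)) mulrA.
Qed.

Lemma ore_twist_iterX k b v : th ((x ^+ k * b) \ot v) = iter k step (th (b \ot v)).
Proof.
elim: k => [|k ih]; first by rewrite expr0 mul1r.
by rewrite exprS -mulrA ore_twistMX // ih.
Qed.

Lemma ore_twistB b b' v : th ((b * b') \ot v) =
  tlift (fun v' d => tlift (fun v'' e => v'' \ot (e * d)) (th (b \ot v')))
    (th (b' \ot v)).
Proof.
have b3 c : bilin (fun (v' : V) (d : B) =>
    tlift (fun v'' e => v'' \ot (e * d)) (th (c \ot v'))).
  split=> [d|v'].
    apply: lcomp; first exact: tlift_linear (rmul_bilin _ d).
    by move=> k y z; rewrite pureEr linearP.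
  by apply: tlift_linearl => y z k d d'; rewrite mulrDr -scalerAr pureEr.
have lb : linear (fun b : B => th ((b * b') \ot v)).
  by move=> c y z; rewrite mulrDl -scalerAl pureEl linearP.
have lb' : linear (fun b : B => tlift (fun v' d =>
    tlift (fun v'' e => v'' \ot (e * d)) (th (b \ot v'))) (th (b' \ot v))).
  apply: tlift_linearl => v' d.
  apply: lcomp; first exact: tlift_linear (rmul_bilin _ d).
  by move=> k y z; rewrite pureEl linearP.
pose F : {linear B -> tens V B} := HB.pack (fun b : B => th ((b * b') \ot v))
  (GRing.isLinear.Build K B (tens V B) _ _ lb).
pose G : {linear B -> tens V B} := HB.pack (fun b : B => tlift (fun v' d =>
    tlift (fun v'' e => v'' \ot (e * d)) (th (b \ot v'))) (th (b' \ot v)))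
  (GRing.isLinear.Build K B (tens V B) _ _ lb').
suff : F b = G b by [].
rewrite (tpoly_sum n_gt0 b) !linear_sum; apply: eq_bigr => k _.
rewrite !linearZ; congr (_ *: _); rewrite /F /G /= ore_twist_iterX.
move: (th (b' \ot v)); apply: tens_ext.
- exact: iter_linear.
- exact: tlift_linear (b3 _).
move=> v' d; rewrite (tlift_pure _ _ (b3 _)) -[x ^+ k]mulr1 ore_twist_iterX.
by rewrite ore_twist1 // rmul_step (tlift_pure _ _ (rmul_bilin _ d)) mul1r.
Qed.

End OreTwistMul.

Record trunc_ore (K : fieldType) (n : nat) (A : algType K) := TruncOre {
  ore_sigma : {lrmorphism A -> A};
  ore_delta : {linear A -> A};
  ore_sigma_bij : bijective ore_sigma;
  ore_deltaM : forall a a',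
    ore_delta (a * a') = ore_delta a * a' + ore_sigma a * ore_delta a';
  ore_scomp0 : forall i j, (i + j)%N = n -> (0 < j)%N ->
    forall a, scomp i j ore_sigma ore_delta a = 0
}.

Section OreTwisting.
Variables (K : fieldType) (n : nat) (A : algType K) (E : trunc_ore n A).
Hypothesis n_gt1 : (1 < n)%N.
Local Notation B := (tpoly K n).
Local Notation x := (xbar K n : B).
Local Notation sg := (ore_sigma E).
Local Notation dl := (ore_delta E).

Definition ore_tau : {linear tens B A -> tens A B} := @ore_twist K n A sg dl.

Let n_gt0 : (0 < n)%N := ltnW n_gt1.
Let s0 := @ore_scomp0 _ _ _ E.

Lemma ore_tau1l a : ore_tau (1 \ot a) = a \ot 1.
Proof. exact: ore_twist1. Qed.

Lemma ore_tauB (b b' : B) a : ore_tau ((b * b') \ot a) =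
  tlift (fun v' d => tlift (fun v'' e => v'' \ot (e * d)) (ore_tau (b \ot v')))
    (ore_tau (b' \ot a)).
Proof. exact: ore_twistB. Qed.

Lemma ore_delta1 : dl 1 = 0.
Proof.
have := ore_deltaM E 1 1; rewrite mulr1 rmorph1 mul1r mulr1 => h.
by apply: (addrI (dl 1)); rewrite addr0 -h.
Qed.

Lemma ore_tau_lin (W : lmodType K) (F G : B -> W) : linear F -> linear G ->
  (forall k, (k < n)%N -> F (x ^+ k) = G (x ^+ k)) -> F =1 G.
Proof.
move=> lF lG h b.
pose F' : {linear B -> W} := HB.pack F (GRing.isLinear.Build K B W _ _ lF).
pose G' : {linear B -> W} := HB.pack G (GRing.isLinear.Build K B W _ _ lG).
suff : F' b = G' b by [].
rewrite (tpoly_sum n_gt0 b) !linear_sum; apply: eq_bigr => k _.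
by rewrite !linearZ /= h.
Qed.

Lemma ore_tau1r b : ore_tau (b \ot 1) = 1 \ot b.
Proof.
move: b; apply: ore_tau_lin.
- by move=> c y z; rewrite pureEl linearP.
- by move=> c y z; rewrite pureEr.
elim=> [|k ih] kn; first by rewrite expr0 ore_tau1l.
rewrite exprS [LHS](ore_twistMX n_gt0 s0 (x ^+ k) 1).
rewrite [X in ore_step _ _ X]ih; last exact: ltnW.
rewrite ore_stepE rmorph1 ore_delta1.
by rewrite (bilin0 _ (bilin_pure A B)) addr0.
Qed.

Lemma ore_tauA b (a v : A) : ore_tau (b \ot (a * v)) =
  tlift (fun c d => tlift (fun v' e => (c * v') \ot e) (ore_tau (d \ot v)))
    (ore_tau (b \ot a)).
Proof.
have b2 (c : A) : bilin (fun (x : A) (e : B) => (c * x) \ot e).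
  split=> [y|y] k u z /=; last by rewrite pureEr.
  by rewrite mulrDr -scalerAr pureEl.
have b3 : bilin (fun (c : A) (d : B) =>
    tlift (fun v' (e : B) => (c * v') \ot e) (ore_tau (d \ot v))).
  split=> [d|c].
    by apply: tlift_linearl => y z k c c'; rewrite mulrDl -scalerAl pureEl.
  apply: lcomp; first exact: tlift_linear (b2 c).
  by move=> k y z; rewrite pureEl linearP.
move: b; apply: ore_tau_lin.
- by move=> c y z; rewrite pureEl linearP.
- apply: lcomp; first exact: tlift_linear b3.
  by move=> c y z; rewrite pureEl linearP.
elim=> [|k ih] kn.
  by rewrite expr0 !ore_tau1l (tlift_pure _ _ b3) ore_tau1l (tlift_pure _ _ (b2 _)).
rewrite exprS; have tX y := ore_twistMX n_gt0 s0 (x ^+ k) y.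
rewrite [LHS]tX [X in ore_step _ _ X]ih; last exact: ltnW.
rewrite [ore_tau (x * _ \ot a)]tX.
rewrite -[ore_twist _ _ (x ^+ k \ot a)]/(ore_tau (x ^+ k \ot a)).
move: (ore_tau (x ^+ k \ot a)); apply: tens_ext.
- by apply: (lcomp (f := ore_step _ _)); [exact: linearP|exact: tlift_linear b3].
- apply: (lcomp (g := ore_step _ _)); first exact: tlift_linear b3.
  exact: linearP.
move=> c d; rewrite (tlift_pure _ _ b3) ore_stepE.
have := tlift_linear b3 1 (sg c \ot (x * d)) (dl c \ot d).
rewrite !scale1r => ->; rewrite !(tlift_pure _ _ b3).
rewrite [ore_tau (x * d \ot v)](ore_twistMX n_gt0 s0) -/(ore_tau _).
rewrite -[ore_twist _ _ (d \ot v)]/(ore_tau (d \ot v)); move: (ore_tau _).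
have l2 c := tlift_linear (b2 c).
apply: (tens_ext (g := fun t => tlift _ (ore_step _ _ t) + tlift _ t)).
- by apply: (lcomp (f := ore_step _ _)); [exact: linearP|exact: l2].
- move=> k' y z; rewrite linearP (l2 (sg c)) (l2 (dl c)) scalerDr.
  by rewrite addrACA.
move=> y e; rewrite ore_stepE (tlift_pure _ _ (b2 c)) ore_stepE.
have := l2 (sg c) 1 (sg y \ot (x * e)) (dl y \ot e); rewrite !scale1r => ->.
rewrite !(tlift_pure _ _ (b2 _)) rmorphM ore_deltaM -addrA; congr (_ + _).
have := pureEl 1 (dl c * y) (sg c * dl y) e; rewrite !scale1r => ->.
by rewrite addrC.
Qed.

Let cf (i : nat) : tens A B -> A := tlift (fun a b => tcoef b i *: a).

Let cf_bilin i : bilin (fun (a : A) (b : B) => tcoef b i *: a).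
Proof.
split=> [b|a] c y z /=; first by rewrite scalerDr !scalerA mulrC.
by rewrite tcoef_linear scalerDl scalerA.
Qed.

Let scomp_sg k a : scomp k 0 sg dl a = iter k sg a.
Proof.
rewrite /scomp (big_pred1 [tuple of nseq (k + 0) true]) => [|w].
  by rewrite /= addn0; elim: k => //= k ->.
apply/idP/eqP => [/eqP h|->]; last by rewrite /= count_nseq mul1n addn0.
apply: val_inj => /=; have : all (pred1 true) w.
  rewrite (eq_all (a2 := id)); last by case.
  by rewrite all_count h size_tuple addn0.
by move/all_pred1P; rewrite size_tuple.
Qed.

Let tauX k a : (k < n)%N ->
  ore_tau (x ^+ k \ot a) = \sum_(i < k.+1) scomp i (k - i) sg dl a \ot x ^+ i.
Proof. by move=> kn; rewrite sum_scomp [LHS]ore_twistX. Qed.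

Lemma ore_tau_inj : injective ore_tau.
Proof.
suff inj0 t : ore_tau t = 0 -> t = 0.
  by move=> t u h; apply/subr0_eq/inj0; rewrite linearB /= h subrr.
have [v ->] : exists v : nat -> A, t = \sum_(k < n) x ^+ k \ot v k.
  pose cg (i : nat) : tens B A -> A := tlift (fun b a => tcoef b i *: a).
  have cgb i : bilin (fun (b : B) (a : A) => tcoef b i *: a).
    split=> [b|a] c y z /=; first by rewrite tcoef_linear scalerDl scalerA.
    by rewrite scalerDr !scalerA mulrC.
  exists (fun i => cg i t); move: t.
  apply: (tens_ext (f := id)) => //.
    move=> c t u; rewrite scaler_sumr -big_split; apply: eq_bigr => i _.
    by rewrite /cg (tlift_linear (cgb i)) pureEr.
  move=> b a; rewrite /cg.
  under eq_bigr do rewrite (tlift_pure _ _ (cgb _)).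
  have h c (b' : B) : (c *: b') \ot a = b' \ot (c *: a).
    have := (bilin_pure B A).1 a c b' 0; rewrite /= addr0 => ->.
    have := (bilin_pure B A).2 b' c a 0; rewrite /= addr0 => ->.
    rewrite (bilin0 _ (bilin_pure B A)); congr (_ + _).
    have := (bilin_pure B A).2 b' (-1) 0 0.
    by rewrite /= scaler0 addr0 scaleN1r addNr => ->.
  under eq_bigr do rewrite -h.
  rewrite {1}(tpoly_sum n_gt0 b); apply: (big_morph (fun u => u \ot a)).
    by move=> u u'; have := pureEl 1 u u' a; rewrite !scale1r.
  exact: (bilin0 a (bilin_pure B A)).
rewrite linear_sum /= => h0.
have sg_iter_inj k : injective (iter k sg).
  by elim: k => //= k ih y z /(bij_inj (ore_sigma_bij E)) /ih.
have v0 m : forall k, (k < n)%N -> (n - m <= k)%N -> v k = 0.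
  elim: m => [|m ih] k kn; first by rewrite subn0 leqNgt kn.
  rewrite leq_eqVlt => /orP [/eqP ek|h]; last by apply: ih => //; lia.
  apply: (sg_iter_inj k); have -> : iter k sg 0 = 0.
    by elim: (k) => //= j ->; rewrite linear0.
  have lc : linear (cf k) := tlift_linear (cf_bilin k).
  pose C : {linear tens A B -> A} :=
    HB.pack (cf k) (GRing.isLinear.Build K (tens A B) A _ _ lc).
  have C0 : cf k 0 = 0 := linear0 C.
  have CS m' (F : 'I_m' -> tens A B) :
    cf k (\sum_(i < m') F i) = \sum_(i < m') cf k (F i) := linear_sum C _ _ _.
  have := congr1 (cf k) h0; rewrite C0 CS (bigD1 (Ordinal kn)) //= tauX // CS.
  rewrite big_ord_recr /= [cf k (_ \ot x ^+ k)](tlift_pure _ _ (cf_bilin k)).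
  rewrite tcoefX // eqxx scale1r subnn scomp_sg.
  rewrite [\sum_(i < k) _]big1 => [|i _]; last first.
    rewrite [LHS](tlift_pure _ _ (cf_bilin k)) tcoefX //; last by have := ltn_ord i; lia.
    by rewrite gtn_eqF ?scale0r.
  rewrite add0r big1 ?addr0 // => i; rewrite -val_eqE /= -[ore_twist _ _ _]/(ore_tau _) => ne.
  have [lt|ge] := ltnP k i.
    rewrite (ih i) //; last by lia.
    by rewrite pure0r linear0 C0.
  rewrite tauX // CS big1 // => j _.
  rewrite [LHS](tlift_pure _ _ (cf_bilin k)) tcoefX //; last first.
    by have := ltn_ord j; have := ltn_ord i; lia.
  rewrite gtn_eqF ?scale0r //; have := ltn_ord j; move: ne; lia.
by rewrite big1 // => k _; rewrite (v0 n) ?subnn // pure0r.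
Qed.

Lemma ore_tau_surj s : exists t, ore_tau t = s.
Proof.
have h k : (k < n)%N -> forall a, exists t, ore_tau t = a \ot x ^+ k.
  elim/ltn_ind: k => k ih kn a.
  have [b <-] : exists b, iter k sg b = a.
    have [ig _ igK] := ore_sigma_bij E.
    by exists (iter k ig a); elim: (k) a => // j ihj y; rewrite iterSr /= igK ihj.
  have [t ht] : exists t, ore_tau t =
      \sum_(i < k) scomp i (k - i) sg dl b \ot x ^+ i.
    elim/big_ind: _ => [|_ _ [t1 <-] [t2 <-]|i _]; first by exists 0; rewrite linear0.
      by exists (t1 + t2); rewrite linearD.
    by apply: ih => //; apply: ltn_trans kn.
  exists (x ^+ k \ot b - t); rewrite linearB /= ht tauX // big_ord_recr /=.
  by rewrite subnn scomp_sg [X in X - _]addrC addrK.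
elim/tens_ind: s => [|_ _ [t1 <-] [t2 <-]|a b]; first by exists 0; rewrite linear0.
  by exists (t1 + t2); rewrite linearD.
rewrite (tpoly_sum n_gt0 b).
elim/big_ind: _ => [|b1 b2 [t1 h1] [t2 h2]|i _].
- by exists 0; rewrite linear0 pure0r.
- exists (t1 + t2); rewrite linearD /= h1 h2.
  by have := pureEr 1 a b1 b2; rewrite !scale1r.
have [t ht] := h i (ltn_ord i) a; exists (tcoef b i *: t); rewrite linearZ /= ht.
by have := pureEr (tcoef b i) a (x ^+ i) 0; rewrite !addr0 pure0r addr0.
Qed.

Lemma ore_tau_bij : bijective ore_tau.
Proof.
pose inv s := projT1 (cid (ore_tau_surj s)).
have invK : cancel inv ore_tau by move=> s; rewrite /inv; case: cid.
by exists inv => // t; apply: ore_tau_inj; rewrite invK.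
Qed.

Definition ore_twisting : twisting_map A B :=
  TwistingMap ore_tau_bij ore_tau1l ore_tau1r
    (tw_mul_crit ore_tau1l ore_tau1r ore_tauB ore_tauA).


End OreTwisting.

Section Homological.
Variable R : pzRingType.

Definition exact_at (U V W : zmodType) (f : U -> V) (g : V -> W) : Prop :=
  forall v, g v = 0 <-> exists u, f u = v.

Definition free_module (V : lmodType R) : Prop :=
  exists (I : choiceType) (e : I -> V),
    (forall v, exists (s : seq I) (c : I -> R), v = \sum_(i <- s) c i *: e i) /\
    (forall (s : seq I) (c : I -> R), uniq s -> \sum_(i <- s) c i *: e i = 0 ->
      {in s, forall i, c i = 0}).

Definition projective_module (V : lmodType R) : Prop :=
  forall (X Y : lmodType R) (g : {linear X -> Y}) (f : {linear V -> Y}),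
    (forall y, exists x, g x = y) ->
    exists h : {linear V -> X}, forall v, g (h v) = f v.

Record resolution (P : nat -> lmodType R) (d : forall i, P i.+1 -> P i)
    (M : lmodType R) (mu : P 0%N -> M) : Prop := Resolution {
  res_d_linear : forall i, linear (d i);
  res_mu_linear : linear mu;
  res_mu_surj : forall m, exists z, mu z = m;
  res_exact0 : exact_at (d 0%N) mu;
  res_exactS : forall i, exact_at (d i.+1) (d i)
}.

Definition free_resolution (P : nat -> lmodType R) (d : forall i, P i.+1 -> P i)
    (M : lmodType R) (mu : P 0%N -> M) : Prop :=
  resolution d mu /\ forall i, free_module (P i).

Definition projective_resolution (P : nat -> lmodType R)
    (d : forall i, P i.+1 -> P i) (M : lmodType R) (mu : P 0%N -> M) : Prop :=
  resolution d mu /\ forall i, projective_module (P i).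

End Homological.

Section DirectSum.
Variables (R : pzRingType) (I : finType) (T : I -> lmodType R).

(* Direct sum over a finite type of indices, as a product.                    *)
Definition dsum : Type := {dffun forall i, T i}.
HB.instance Definition _ := Choice.copy dsum {dffun forall i, T i}.

Definition dsum_add (f g : dsum) : dsum := [ffun i => f i + g i].
Definition dsum_zero : dsum := [ffun i => 0].
Definition dsum_opp (f : dsum) : dsum := [ffun i => - f i].
Definition dsum_scale (c : R) (f : dsum) : dsum := [ffun i => c *: f i].

Fact dsum_addA : associative dsum_add.
Proof. by move=> f g h; apply/ffunP => i; rewrite !ffunE addrA. Qed.
Fact dsum_addC : commutative dsum_add.
Proof. by move=> f g; apply/ffunP => i; rewrite !ffunE addrC. Qed.
Fact dsum_add0 : left_id dsum_zero dsum_add.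
Proof. by move=> f; apply/ffunP => i; rewrite !ffunE add0r. Qed.
Fact dsum_addN : left_inverse dsum_zero dsum_opp dsum_add.
Proof. by move=> f; apply/ffunP => i; rewrite !ffunE addNr. Qed.

HB.instance Definition _ :=
  GRing.isZmodule.Build dsum dsum_addA dsum_addC dsum_add0 dsum_addN.

Fact dsum_scaleA a b f : dsum_scale a (dsum_scale b f) = dsum_scale (a * b) f.
Proof. by apply/ffunP => i; rewrite !ffunE scalerA. Qed.
Fact dsum_scale1 : left_id 1 dsum_scale.
Proof. by move=> f; apply/ffunP => i; rewrite !ffunE scale1r. Qed.
Fact dsum_scaleDr : right_distributive dsum_scale +%R.
Proof. by move=> a f g; apply/ffunP => i; rewrite !ffunE scalerDr. Qed.
Fact dsum_scaleDl f : {morph dsum_scale^~ f : a b / a + b}.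
Proof. by move=> a b; apply/ffunP => i; rewrite !ffunE scalerDl. Qed.

HB.instance Definition _ := GRing.Zmodule_isLmodule.Build R dsum
  dsum_scaleA dsum_scale1 dsum_scaleDr dsum_scaleDl.

End DirectSum.

Record compatible_resolution (K : fieldType) (A B : algType K)
    (tau : {linear tens B A -> tens A B})
    (M : lmodType A) (thM : {linear tens B (kmod M) -> tens (kmod M) B})
    (P : nat -> lmodType A) (d : forall i, {linear P i.+1 -> P i})
    (mu : {linear P 0%N -> M})
    (th : forall i, {linear tens B (kmod (P i)) -> tens (kmod (P i)) B}) : Prop :=
  CompatibleResolution {
  cr_compat : forall i, compatible tau (th i);
  cr_chain : forall i (t : tens B (kmod (P i.+1))),
    tmap (kmap (d i)) (@idfun B) (th i.+1 t) =
    th i (tmap (@idfun B) (kmap (d i)) t);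
  cr_lift : forall t : tens B (kmod (P 0%N)),
    tmap (kmap mu) (@idfun B) (th 0%N t) = thM (tmap (@idfun B) (kmap mu) t)
}.

(* Pairs (i, j) with i + j = k, and the pairs (i + 1, j) and (i, j + 1) of    *)
(* total degree k + 1; their components are convertible to i.+1 and j.+1.     *)
Definition bideg (k : nat) : finType :=
  {p : 'I_k.+1 * 'I_k.+1 | p.1 + p.2 == k}%N.

Section Bidegree.
Variables (k : nat) (p : bideg k).

Definition bdl : nat := (val p).1.
Definition bdr : nat := (val p).2.

Definition bideg_incl : bideg k.+1.
Proof.
exists (Ordinal (ltn_ord (val p).1 : (val p).1.+1 < k.+2)%N,
        Ordinal (leqW (ltn_ord (val p).2))).
by rewrite /= addSn eqSS (valP p).
Defined.

Definition bideg_incr : bideg k.+1.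
Proof.
exists (Ordinal (leqW (ltn_ord (val p).1)),
        Ordinal (ltn_ord (val p).2 : (val p).2.+1 < k.+2)%N).
by rewrite /= addnS eqSS (valP p).
Defined.

End Bidegree.

Definition bideg0 : bideg 0 := exist _ (ord0, ord0) (eqxx 0%N).

Section TwistedProductComplex.
Variables (K : fieldType) (A B : algType K) (tau : twisting_map A B).
Variables (P : nat -> lmodType A) (dP : forall i, {linear P i.+1 -> P i}).
Variable th : forall i, {linear tens B (kmod (P i)) -> tens (kmod (P i)) B}.
Hypothesis cP : forall i, compatible tau (th i).
Variables (Q : nat -> lmodType B) (dQ : forall j, {linear Q j.+1 -> Q j}).

(* X_k = \bigoplus_(i + j = k) P_i \ot Q_j; the component of the differential  *)
(* at (i, j) comes from the components at (i + 1, j) and (i, j + 1).          *)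
Definition tpc (k : nat) : lmodType (twtens tau) :=
  dsum (fun p : bideg k => twmod (cP (bdl p)) (Q (bdr p))).

Definition tpc_d (k : nat) (w : tpc k.+1) : tpc k :=
  [ffun p : bideg k =>
     tmap (kmap (dP (bdl p))) (@idfun (kmod (Q (bdr p)))) (w (bideg_incl p)) +
     (-1) ^+ bdl p *:
       tmap (@idfun (kmod (P (bdl p)))) (kmap (dQ (bdr p))) (w (bideg_incr p))].

(* The augmentation X_0 = P_0 \ot Q_0 -> M \ot N.                              *)
Definition tpc_aug (M : lmodType A) (mu : {linear P 0%N -> M})
    (N : lmodType B) (eta : {linear Q 0%N -> N}) (w : tpc 0%N) :
    tens (kmod M) (kmod N) :=
  tmap (kmap mu) (kmap eta) (w bideg0).

End TwistedProductComplex.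

Arguments tpc_d {K A B tau P} dP {th} cP {Q} dQ k w.
Arguments tpc_aug {K A B tau P th} cP {Q M} mu {N} eta w.

Section StandardResolution.
Variables (K : fieldType) (n : nat).
Local Notation B := (tpoly K n).

Definition teps (b : B) : K := tcoef b 0.

Fact teps_zmod : zmod_morphism teps.
Proof.
move=> b b'; have := tcoef_linear 0 (-1) b' b.
by rewrite scaleN1r mulN1r addrC [RHS]addrC.
Qed.

Fact teps_monoid : monoid_morphism teps.
Proof.
split=> [|b b']; first by rewrite /teps /tcoef /= coef1.
pose h := mk_monic ('X^n : {poly K}).
have mh : h \is monic by rewrite /h mk_monic_Xn monicXn.
have h0 : h`_0 = 0 by rewrite /h mk_monic_Xn coefXn.
rewrite /teps /tcoef -coef0M.
by rewrite [in RHS](Pdiv.RingMonic.rdivp_eq mh (_ * _)) coefD coef0M h0 mulr0 add0r.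
Qed.

HB.instance Definition _ := GRing.isZmodMorphism.Build B K teps teps_zmod.
HB.instance Definition _ := GRing.isMonoidMorphism.Build B K teps teps_monoid.

Definition ktriv : lmodType B := restr teps K^o.

Definition stdres (j : nat) : lmodType B := B^o.

Definition stdres_mul (j : nat) (b : stdres j.+1) : stdres j :=
  (if odd j then xbar K n ^+ n.-1 else xbar K n) * b.

Fact stdres_mul_linear j : linear (@stdres_mul j).
Proof. by move=> c b b'; rewrite /stdres_mul mulrDr; congr (_ + _); apply: mulrCA. Qed.

HB.instance Definition _ j :=
  GRing.isLinear.Build B (stdres j.+1) (stdres j) _ (@stdres_mul j) (@stdres_mul_linear j).

Definition stdres_d (j : nat) : {linear stdres j.+1 -> stdres j} := @stdres_mul j.

Definition stdres_eps (b : stdres 0%N) : ktriv := teps b.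

Fact stdres_eps_linear : linear stdres_eps.
Proof. by move=> c b b'; rewrite /stdres_eps rmorphD rmorphM. Qed.

HB.instance Definition _ :=
  GRing.isLinear.Build B (stdres 0%N) ktriv _ stdres_eps stdres_eps_linear.

Definition stdres_aug : {linear stdres 0%N -> ktriv} := stdres_eps.

(* The identification V \ot K = V.                                            *)
Definition tensk (V : lmodType K) : tens V (kmod ktriv) -> V :=
  tlift (fun (v : V) (c : kmod ktriv) => (c : K) *: v).

Fact tensk_bilin (V : lmodType K) :
  bilin (fun (v : V) (c : kmod ktriv) => (c : K) *: v).
Proof.
split=> [c k v v'|v k c c'] /=; first by rewrite scalerDr !scalerA mulrC.
have -> : (k *: c + c' : kmod ktriv) = (k * (c : K) + (c' : K) : K) :> K.
  rewrite -[LHS]/(teps (k%:A : B) * (c : K) + (c' : K)) /teps.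
  have := tcoef_linear 0 k (1 : B) 0; rewrite addr0 => ->.
  by rewrite -!/(teps _) rmorph0 rmorph1 mulr1 addr0.
by rewrite scalerDl scalerA.
Qed.

End StandardResolution.

Section OreModule.
Variables (K : fieldType) (n : nat) (A : algType K) (E : trunc_ore n A).
Hypothesis n_gt1 : (1 < n)%N.
Local Notation tau := (ore_twisting E n_gt1).
Local Notation B := (tpoly K n).

Definition ore_alg : pzRingType := twtens tau.

Definition ore_resA (M : lmodType ore_alg) : lmodType A := restr (inA tau) M.

Definition ore_x (M : lmodType ore_alg) (m : kmod (ore_resA M)) : kmod (ore_resA M) :=
  inB tau (xbar K n) *: (m : M).

Fact ore_x_linear (M : lmodType ore_alg) : linear (@ore_x M).
Proof.
move=> c u v; rewrite /ore_x [LHS](@scalerDr _ M); congr (_ + _).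
have e : inB tau (xbar K n) * inA tau c%:A = inA tau c%:A * inB tau (xbar K n).
  rewrite inB_inA inA_inB.
  have := pureEr c (xbar K n) (1 : A) 0; rewrite pure0r !addr0 => ->.
  rewrite linearZ /= [X in _ *: X]ore_tau1r //.
  by have := pureEl c (1 : A) 0 (xbar K n); rewrite pure0l !addr0 => ->.
apply: etrans (@scalerA ore_alg M (inB tau (xbar K n)) (inA tau c%:A) u) _.
by rewrite e -scalerA.
Qed.

HB.instance Definition _ (M : lmodType ore_alg) :=
  GRing.isLinear.Build K (kmod (ore_resA M)) (kmod (ore_resA M)) _ (@ore_x M)
    (@ore_x_linear M).

Definition ore_tauM (M : lmodType ore_alg)
    (phi : {linear ore_resA M -> restr (ore_sigma E) (ore_resA M)}) :
    {linear tens B (kmod (ore_resA M)) -> tens (kmod (ore_resA M)) B} :=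
  ore_twist (skmap phi) (@ore_x M).

Definition ore_tauP (P : lmodType A)
    (sg : {linear P -> restr (ore_sigma E) P}) (dl : {linear kmod P -> kmod P}) :
    {linear tens B (kmod P) -> tens (kmod P) B} :=
  ore_twist (skmap sg) dl.

End OreModule.

(* Main.v *)
Require Import Defs.
From HB Require Import structures.
From mathcomp Require Import all_boot all_order all_algebra.
From mathcomp Require Import boolp zify.

Set Implicit Arguments.
Unset Strict Implicit.
Unset Printing Implicit Defensive.

Import GRing.Theory.
Local Open Scope ring_scope.

(* Projectivity: the bijection tau_{B,i} identifies P_i \ot B with the module  *)
(* induced from P_i along A -> A \ot_tau B, and an induced module is           *)
(* projective as soon as P_i is.                                               *)
(* Exactness: the columns P_* \ot B -> M \ot B are exact because B is free     *)
(* over K on the powers of x, and the row M \ot P_*(B) -> M is exact by        *)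
(* comparing coefficients.  A preimage (u_i) of a cycle (w_i) of the total     *)
(* complex is built by increasing i: u_0 comes from exactness of the row of M, *)
(* and u_{i+1} from exactness of the column containing                         *)
(* w_i - (-1)^i (1 \ot d'')(u_i).                                              *)

Section Projective.
Variable R : pzRingType.

Lemma sum_by_index (I : choiceType) (W : lmodType R) (y : I -> W) (r : seq (R * I)) :
  \sum_(p <- r) p.1 *: y p.2 =
  \sum_(i <- undup (map snd r)) (\sum_(p <- r | p.2 == i) p.1) *: y i.
Proof.
transitivity (\sum_(i <- undup (map snd r)) \sum_(p <- r | p.2 == i) p.1 *: y p.2).
  rewrite (exchange_big_dep xpredT) //= big_seq [RHS]big_seq.
  apply: eq_bigr => p pr; rewrite -big_filter (eq_filter (a2 := pred1 p.2)).
    by rewrite filter_pred1_uniq ?undup_uniq ?big_seq1 // mem_undup map_f.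
  by move=> i; rewrite /= eq_sym.
by apply: eq_bigr => i _; rewrite scaler_suml; apply: eq_bigr => p /eqP ->.
Qed.

Lemma free_projective (V : lmodType R) : free_module V -> projective_module V.
Proof.
move=> [I [e [span indep]]] X Y g f gsurj.
have [x xP] := choice (fun i => gsurj (f (e i))).
have wd (r : seq (R * I)) :
    \sum_(p <- r) p.1 *: e p.2 = 0 -> \sum_(p <- r) p.1 *: x p.2 = 0.
  rewrite !sum_by_index => /indep c0; rewrite big_seq big1 // => i ir.
  by rewrite c0 ?undup_uniq ?scale0r.
have span' v : exists r : seq (R * I), v = \sum_(p <- r) p.1 *: e p.2.
  by have [s [c ->]] := span v; exists [seq (c i, i) | i <- s]; rewrite big_map.
have [r rP] := choice span'.
pose h v := \sum_(p <- r v) p.1 *: x p.2.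
have hl : linear h.
  move=> c u v; apply/eqP; rewrite -subr_eq0; apply/eqP.
  pose sc (a : R) (s : seq (R * I)) := [seq (a * p.1, p.2) | p <- s].
  have scE (W : lmodType R) (y : I -> W) a s :
      \sum_(p <- sc a s) p.1 *: y p.2 = a *: \sum_(p <- s) p.1 *: y p.2.
    by rewrite big_map scaler_sumr; apply: eq_bigr => p _; rewrite scalerA.
  have := wd (r (c *: u + v) ++ sc (- c) (r u) ++ sc (-1) (r v)).
  rewrite !big_cat /= !scE -!rP -/(h _) -/(h u) -/(h v).
  by rewrite !scaleNr !scale1r opprD; apply; rewrite -opprD subrr.
pose hL : {linear V -> X} := HB.pack h (GRing.isLinear.Build R V X _ h hl).
exists hL => v; rewrite /hL /=.
rewrite /h linear_sum [in RHS](rP v) linear_sum.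
by apply: eq_bigr => p _; rewrite !linearZ xP.
Qed.

Lemma dsumP (I : finType) (T : I -> lmodType R) (u v : dsum T) :
  (forall i, u i = v i) -> u = v.
Proof. by move=> h; apply/ffunP. Qed.

Lemma dsum_linE (I : finType) (T : I -> lmodType R) c (u v : dsum T) i :
  (c *: u + v) i = c *: u i + v i.
Proof. by rewrite /= !ffunE. Qed.

Lemma dsum_projective (I : finType) (T : I -> lmodType R) :
  (forall i, projective_module (T i)) -> projective_module (dsum T).
Proof.
move=> pT X Y g f gsurj.
pose inj i (v : T i) : dsum T := [ffun j => dfwith (fun j => 0 : T j) v j].
have injl i : linear (@inj i).
  move=> c u v; apply: (@dsumP _ T) => j; rewrite dsum_linE !ffunE.
  have [->|ne] := eqVneq j i; first by rewrite !dfwith_in.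
  by rewrite !dfwith_out ?scaler0 ?addr0 // eq_sym.
pose injL i : {linear T i -> dsum T} :=
  HB.pack (@inj i) (GRing.isLinear.Build R (T i) (dsum T) _ _ (injl i)).
have dsumE (w : dsum T) : w = \sum_i injL i (w i).
  apply: (@dsumP _ T) => j.
  have -> : (\sum_i injL i (w i)) j = \sum_i (injL i (w i)) j.
    apply: (big_morph (fun u : dsum T => u j)) => [u v|]; last by rewrite ffunE.
    by have := dsum_linE 1 u v j; rewrite !scale1r.
  rewrite (bigD1 j) //= ffunE dfwith_in.
  by rewrite big1 ?addr0 // => i ne; rewrite ffunE dfwith_out.
have lift i : exists h : {linear T i -> X}, forall v, g (h v) = f (injL i v).
  exact: (pT i X Y g (f \o injL i)).
pose h i := projT1 (cid (lift i)).
have hP i : forall v, g (h i v) = f (injL i v) := projT2 (cid (lift i)).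
pose H (w : dsum T) := \sum_i h i (w i).
have Hl : linear H.
  move=> c u v; rewrite /H scaler_sumr -big_split; apply: eq_bigr => i _ /=.
  by rewrite dsum_linE linearP.
pose HL : {linear dsum T -> X} :=
  HB.pack H (GRing.isLinear.Build R (dsum T) X _ H Hl).
exists HL => w; rewrite /HL /=.
rewrite /H linear_sum [in RHS](dsumE w) linear_sum.
by apply: eq_bigr => i _.
Qed.

End Projective.

Lemma tens_addE (K : fieldType) (U V W : lmodType K) (f : tens U V -> W) :
  linear f -> forall t u, f (t + u) = f t + f u.
Proof. by move=> lf t u; have := lf 1 t u; rewrite !scale1r. Qed.

Section RestrMap.
Variables (R S : pzRingType) (r : {rmorphism R -> S}) (X Y : lmodType S).

Definition rmap (g : {linear X -> Y}) : restr r X -> restr r Y := g.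

Fact rmap_linear (g : {linear X -> Y}) : linear (rmap g).
Proof. by move=> a u v; rewrite /rmap [LHS]linearP. Qed.

HB.instance Definition _ (g : {linear X -> Y}) :=
  GRing.isLinear.Build R (restr r X) (restr r Y) _ (rmap g) (rmap_linear g).

End RestrMap.

Section Regular.
Variables (K : fieldType) (B : algType K).

(* [kmod B^o] scales by [c%:A * _], which is not convertible to [c *: _].      *)
Definition toreg (b : B) : kmod B^o := b.
Definition ofreg (b : kmod B^o) : B := b.

Fact toreg_linear : linear toreg.
Proof. by move=> c u v; rewrite /toreg kmodE /= [X in _ = X + _]mulr_algl. Qed.
Fact ofreg_linear : linear ofreg.
Proof. by move=> c u v; rewrite /ofreg -mulr_algl. Qed.

HB.instance Definition _ := GRing.isLinear.Build K B (kmod B^o) _ toreg toreg_linear.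
HB.instance Definition _ := GRing.isLinear.Build K (kmod B^o) B _ ofreg ofreg_linear.

Variable V : lmodType K.

Lemma toregK (t : tens V B) : tmap (@idfun V) ofreg (tmap (@idfun V) toreg t) = t.
Proof.
move: t; apply: (tens_ext (f := fun t => tmap _ _ (tmap _ _ t))) => //.
  by apply: (lcomp (f := tmap _ _)); apply: linearP.
by move=> v b; rewrite !tmapE.
Qed.

Lemma ofregK (t : tens V (kmod B^o)) :
  tmap (@idfun V) toreg (tmap (@idfun V) ofreg t) = t.
Proof.
move: t; apply: (tens_ext (f := fun t => tmap _ _ (tmap _ _ t))) => //.
  by apply: (lcomp (f := tmap _ _)); apply: linearP.
by move=> v b; rewrite !tmapE.
Qed.

End Regular.

Section TwistedModules.
Variables (K : fieldType) (A B : algType K) (tau : twisting_map A B).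

Section Action.
Variables (M : lmodType A) (th : {linear tens B (kmod M) -> tens (kmod M) B}).
Hypothesis cM : compatible tau th.
Variable N : lmodType B.

Fact twact_pure_bilin (a : A) (q : kmod N) : bilin (fun (z : kmod M) (e : B) =>
  ((a *: (z : M)) : kmod M) \ot ((e *: (q : N)) : kmod N)).
Proof.
split=> [e|z] c u v /=.
  by rewrite ((tact_bilin M).2 a) pureEl.
by rewrite ((tact_bilin N).1 q) pureEr.
Qed.

Lemma twact_pure (a : A) (b : B) (z : kmod M) (q : kmod N) :
  twact (cM := cM) (N := N) (a \ot b) (z \ot q) =
  tlift (fun (z' : kmod M) (e : B) =>
    ((a *: (z' : M)) : kmod M) \ot ((e *: (q : N)) : kmod N)) (th (b \ot z)).
Proof.
rewrite /twact tmidE; move: (th _).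
apply: (tens_ext (f := fun s => tmap _ _ (tlift _ s))).
- apply: lcomp; first exact: linearP.
  exact/tlift_linear/tmid_bilin1.
- exact/tlift_linear/twact_pure_bilin.
move=> z' e; rewrite (tlift_pure _ _ (tmid_bilin1 _ _ _ _)).
by rewrite (tlift_pure _ _ (twact_pure_bilin _ _)) tmapE /= !tactE.
Qed.

Lemma twact_inA (a : A) (z : kmod M) (q : kmod N) :
  inA tau a *: ((z \ot q) : twmod cM N) = ((a *: (z : M)) : kmod M) \ot q.
Proof.
rewrite [LHS]twact_pure (compat1 cM) (tlift_pure _ _ (twact_pure_bilin _ _)).
by congr (_ \ot _); exact: (@scale1r B N).
Qed.

Fact twact_inB_bilin (V : lmodType K) (q : kmod N) :
  bilin (fun (v : V) (e : B) => v \ot ((e *: (q : N)) : kmod N)).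
Proof.
split=> [e|z] c u v /=; first by rewrite pureEl.
by rewrite ((tact_bilin N).1 q) pureEr.
Qed.

Lemma twact_inB (b : B) (z : kmod M) (q : kmod N) :
  inB tau b *: ((z \ot q) : twmod cM N) =
  tlift (fun (z' : kmod M) (e : B) => z' \ot ((e *: (q : N)) : kmod N)) (th (b \ot z)).
Proof.
rewrite [LHS]twact_pure; congr (tlift _ _); apply/funext => z'; apply/funext => e.
by congr (_ \ot _); exact: (@scale1r A M).
Qed.

Lemma twact_linear (t : twtens tau) :
  linear (twact (cM := cM) (N := N) t :
    tens (kmod M) (kmod N) -> tens (kmod M) (kmod N)).
Proof.
apply: (lcomp (f := fun s => tmap _ _ (tmid th s))).
  by apply: (lcomp (f := tmap _ _)); exact: linearP.
by move=> c u v; rewrite pureEr.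
Qed.

Lemma twact_linearl (w : twmod cM N) :

  linear ((fun t => twact (cM := cM) (N := N) t w) :
    tens A B -> tens (kmod M) (kmod N)).
Proof.
apply: (lcomp (f := fun s => tmap _ _ (tmid th s))).
  by apply: (lcomp (f := tmap _ _)); exact: linearP.
by move=> c u v; rewrite pureEl.
Qed.

End Action.

Section Naturality.
Variables (M M' : lmodType A) (th : {linear tens B (kmod M) -> tens (kmod M) B}).
Variable th' : {linear tens B (kmod M') -> tens (kmod M') B}.
Hypotheses (cM : compatible tau th) (cM' : compatible tau th').
Variables (N N' : lmodType B) (f : {linear M -> M'}) (g : {linear N -> N'}).
Hypothesis fth : forall t : tens B (kmod M),
  tmap (kmap f) (@idfun B) (th t) = th' (tmap (@idfun B) (kmap f) t).

Lemma twact_natural (t : twtens tau) (w : twmod cM N) :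
  tmap (kmap f) (kmap g) (twact (cM := cM) (N := N) t w) =
  twact (cM := cM') (N := N') t (tmap (kmap f) (kmap g) w).
Proof.
move: t; apply: (tens_ext (f := fun t => tmap _ _ (twact _ _))).
- by apply: (lcomp (f := tmap _ _)); [exact: linearP|exact: twact_linearl].
- exact: twact_linearl.
move=> a b; move: w; apply: (tens_ext (f := fun w => tmap _ _ (twact _ _))).
- by apply: (lcomp (f := tmap _ _)); [exact: linearP|exact: twact_linear].
- apply: lcomp; [exact: twact_linear|exact: linearP].
move=> z q; rewrite tmapE !twact_pure.
have -> : th' (b \ot kmap f z) = tmap (kmap f) (@idfun B) (th (b \ot z)).
  by rewrite fth tmapE.
move: (th _); apply: (tens_ext (f := fun s => tmap _ _ (tlift _ s))).
- apply: lcomp; first exact: linearP.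
  exact/tlift_linear/twact_pure_bilin.
- apply: lcomp; last exact: linearP.
  exact/tlift_linear/twact_pure_bilin.
move=> z' e; rewrite tmapE (tlift_pure _ _ (@twact_pure_bilin M N a q)) tmapE.
rewrite (tlift_pure _ _ (@twact_pure_bilin M' N' a (kmap g q))).
by congr (_ \ot _); apply: linearZ.
Qed.

End Naturality.

Section Induced.
Variables (M : lmodType A) (th : {linear tens B (kmod M) -> tens (kmod M) B}).
Hypothesis cM : compatible tau th.

Lemma tw_inB_central (b : B) (c : K) :
  inB tau b * inA tau c%:A = inA tau c%:A * inB tau b.
Proof.
rewrite inB_inA inA_inB; have := pureEr c b (1 : A) 0.
rewrite pure0r !addr0 => ->; rewrite linearZ /= tw_1r.
by have := pureEl c (1 : A) 0 b; rewrite pure0l !addr0.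
Qed.


Lemma inB_generate (b : B) (z : kmod M) :
  inB tau b *: ((z \ot (1 : kmod B^o)) : twmod cM B^o) =
  tmap (@idfun (kmod M)) (@toreg K B) (th (b \ot z)).
Proof.
rewrite twact_inB /tmap; congr (tlift _ _).
by apply/funext => z'; apply/funext => e; congr (_ \ot _); apply: mulr1.
Qed.

Lemma twmod_projective : projective_module M -> projective_module (twmod cM B^o).
Proof.
move=> pM X Y g f gsurj.
pose f0 (z : M) : restr (inA tau) Y := f ((z : kmod M) \ot (1 : kmod B^o)).
have f0l : linear f0.
  move=> a u v; pose e (z : M) : twmod cM B^o := (z : kmod M) \ot (1 : kmod B^o).
  have eE : e (a *: u + v) = inA tau a *: e u + e v.
    rewrite twact_inA.
    by have := pureEl 1 (a *: u : kmod M) v (1 : kmod B^o); rewrite !scale1r.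
  by rewrite /f0 -!/(e _) eE linearP.
pose fA : {linear M -> restr (inA tau) Y} :=
  HB.pack f0 (GRing.isLinear.Build A M (restr (inA tau) Y) _ _ f0l).
have [h0 h0P] :=
  pM (restr (inA tau) X) (restr (inA tau) Y) (rmap (r := inA tau) g) fA gsurj.
pose XK := kmod (restr (inA tau) X).
pose gen_img (b : B) (z : kmod M) : XK := inB tau b *: (h0 z : X).
pose G : tens B (kmod M) -> XK := tlift gen_img.
have Gb : bilin gen_img.
  split=> [z c b b'|b c z z'].
    have e : inB tau (c *: b + b') = inA tau c%:A * inB tau b + inB tau b'.
      rewrite inA_inB /inB pureEr; congr (_ + _).
      by have := pureEl c (1 : A) 0 b; rewrite pure0l !addr0 => ->.
    rewrite /= /gen_img e.
    by rewrite [LHS](@scalerDl _ X) -(@scalerA _ X).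
  have e : h0 (c *: z + z') = inA tau c%:A *: (h0 z : X) + (h0 z' : X).
    exact: linearP h0 c%:A z z'.
  rewrite /= /gen_img e [LHS](@scalerDr _ X) (@scalerA _ X) tw_inB_central.
  by rewrite -(@scalerA _ X).
have Gl : linear G := tlift_linear Gb.
have [thV thK thVK] := compat_bij cM.
pose H (w : twmod cM B^o) : X := G (thV (tmap (@idfun (kmod M)) (@ofreg K B) w)).
have HE b z : H (inB tau b *: ((z \ot (1 : kmod B^o)) : twmod cM B^o)) =
    inB tau b *: (h0 z : X).
  by rewrite inB_generate /H toregK thK; exact: tlift_pure Gb.
have H1 z : H ((z \ot (1 : kmod B^o)) : twmod cM B^o) = h0 z.
  have := HE 1 z; have -> : inB tau 1 = 1 by [].
  by rewrite !scale1r.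
have HD u v : H (u + v) = H u + H v.
  rewrite /H linearD /= -(tens_addE Gl); congr G.
  by apply: (can_inj thK); rewrite linearD !thVK.
have H0 : H 0 = 0 by apply: (addrI (H 0)); rewrite -HD !addr0.
have gen (Q : twmod cM B^o -> Prop) : (forall u v, Q u -> Q v -> Q (u + v)) ->
    Q 0 -> (forall b z, Q (inB tau b *: ((z \ot (1 : kmod B^o)) : twmod cM B^o))) ->
    forall w, Q w.
  move=> QD Q0 Qp w; rewrite -[w]ofregK -[X in tmap _ (@toreg K B) X]thVK.
  elim/tens_ind: (thV _) => [|t u ht hu|b z].
  - by rewrite !linear0.
  - by rewrite !linearD; apply: QD.
  - by rewrite -inB_generate.
have HB b w : H (inB tau b *: w) = inB tau b *: H w.
  elim/gen: w => [u v hu hv||b' z].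
  - by rewrite scalerDr !HD scalerDr hu hv.
  - by rewrite !scaler0 H0 scaler0.
  - by rewrite scalerA -inBM !HE inBM scalerA.
have HA a w : H (inA tau a *: w) = inA tau a *: H w.
  elim/gen: w => [u v hu hv||b z].
  - by rewrite scalerDr !HD scalerDr hu hv.
  - by rewrite !scaler0 H0 scaler0.
  rewrite HE !scalerA inA_inB.
  have [tV _ tVK] := tw_bij tau; rewrite -[a \ot b]tVK.
  elim/tens_ind: (tV _) => [|t u ht hu|b' a'].
  - by rewrite linear0 !scale0r H0.
  - by rewrite linearD /= !scalerDl HD ht hu.
  - rewrite -inB_inA -!scalerA HB twact_inA; congr (_ *: _).
    by rewrite [LHS]H1; exact: (linearZ_LR h0).
have Hl : linear H.
  move=> t u v; rewrite HD; congr (_ + _).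
  elim/tens_ind: t => [|t t' ht ht'|a b].
  - by rewrite !scale0r H0.
  - by rewrite !scalerDl HD ht ht'.
  - by rewrite -inA_inB -!scalerA HA HB.
pose HL : {linear twmod cM B^o -> X} :=
  HB.pack H (GRing.isLinear.Build (twtens tau) (twmod cM B^o) X _ H Hl).
exists HL => w; rewrite /HL /=.
elim/gen: w => [u v hu hv||b z].
- by rewrite HD !linearD hu hv.
- by rewrite H0 !linear0.
- by rewrite HE !linearZ; congr (_ *: _); exact: h0P.
Qed.
End Induced.

End TwistedModules.

Section Coordinates.
Variables (K : fieldType) (n : nat).
Hypothesis n_gt0 : (0 < n)%N.
Local Notation B := (tpoly K n).
Local Notation x := (xbar K n : B).
Local Notation Breg := (kmod (B^o : lmodType B)).

Lemma tcoef_sum (I : Type) (r : seq I) (F : I -> B) k :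
  tcoef (\sum_(i <- r) F i) k = \sum_(i <- r) tcoef (F i) k.
Proof.
apply: (big_morph (fun b : B => tcoef b k)) => [u v|]; last by rewrite /tcoef coef0.
by have := tcoef_linear k 1 u v; rewrite scale1r mul1r.
Qed.

Lemma tcoefMX m k (b : B) : (m + k < n)%N -> tcoef (x ^+ m * b) (m + k) = tcoef b k.
Proof.
move=> mk; have kn : (k < n)%N by lia.
rewrite {1}(tpoly_sum n_gt0 b) mulr_sumr tcoef_sum (bigD1 (Ordinal kn)) //=.
have scE c i : x ^+ m * (c *: x ^+ i) = c *: x ^+ (m + i) + 0.
  by rewrite addr0 -scalerAr exprD.
have t0 : tcoef (0 : B) (m + k) = 0 by rewrite /tcoef coef0.
rewrite scE tcoef_linear tcoefX // eqxx mulr1 t0 addr0 big1 ?addr0 // => i ne.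
rewrite scE tcoef_linear t0 addr0; have [lt|le] := ltnP (m + i) n.
  rewrite tcoefX // eqn_add2l; case: eqP => [e|_]; last by rewrite mulr0.
  by move: ne; rewrite -val_eqE /= e eqxx.
by rewrite -(subnKC le) exprD tpoly_xn // mul0r t0 mulr0.
Qed.

Lemma tcoef_xM0 (b : B) : (1 < n)%N -> tcoef (x * b) 0 = 0.
Proof.
move=> n_gt1; rewrite -[LHS]/(teps _) rmorphM /= {1}/teps -[x]expr1.
by rewrite tcoefX // mul0r.
Qed.

Section Coord.
Variable V : lmodType K.

Definition xcoef (k : nat) : tens V Breg -> V :=
  tlift (fun v (b : Breg) => tcoef (b : B) k *: v).

Fact xcoef_bilin k : bilin (fun (v : V) (b : Breg) => tcoef (b : B) k *: v).
Proof.
split=> [b|v] c y z /=; first by rewrite scalerDr !scalerA mulrC.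
have -> : (c *: y + z : Breg) = (c *: (y : B) + z : B) by rewrite -mulr_algl.
by rewrite tcoef_linear scalerDl scalerA.
Qed.

HB.instance Definition _ k := GRing.isLinear.Build K (tens V Breg) V _
  (xcoef k) (tlift_linear (xcoef_bilin k)).

Lemma xcoefE k v (b : Breg) : xcoef k (v \ot b) = tcoef (b : B) k *: v.
Proof. exact: tlift_pure (xcoef_bilin k). Qed.

Definition xtens (v : V) (k : nat) : tens V Breg := v \ot (x ^+ k : Breg).

Fact xtens_linear k : linear (xtens^~ k).
Proof. by move=> c u v; exact: pureEl. Qed.

Lemma xcoef_sum (t : tens V Breg) : t = \sum_(k < n) xtens (xcoef k t) k.
Proof.
move: t; apply: (tens_ext (f := id)) => //.
  move=> c t u; rewrite scaler_sumr -big_split; apply: eq_bigr => k _.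
  by rewrite linearP xtens_linear.
move=> v b; transitivity (\sum_(k < n) v \ot (tcoef (b : B) k *: (x ^+ k : B) : Breg)).
  rewrite {1}(tpoly_sum n_gt0 (b : B)).
  apply: (big_morph (fun u : Breg => v \ot u)); last exact: pure0r.
  by move=> y z; have := pureEr 1 v y z; rewrite !scale1r.
apply: eq_bigr => k _; rewrite xcoefE.
have := pureEl (tcoef (b : B) k) v 0 (x ^+ k : Breg); rewrite /xtens pure0l !addr0 => ->.
have := pureEr (tcoef (b : B) k) v (x ^+ k : Breg) 0; rewrite pure0r !addr0 => <-.
by congr (_ \ot _); rewrite -mulr_algl.
Qed.

Lemma xcoef_inj (t u : tens V Breg) : (forall k, (k < n)%N -> xcoef k t = xcoef k u) -> t = u.
Proof.
by move=> h; rewrite (xcoef_sum t) (xcoef_sum u); apply: eq_bigr => k _; rewrite h.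
Qed.

End Coord.

Lemma xcoef_map (V W : lmodType K) (f : {linear V -> W}) k (t : tens V Breg) :
  xcoef k (tmap f (@idfun Breg) t) = f (xcoef k t).
Proof.
move: t; apply: (tens_ext (f := fun t => xcoef k (tmap _ _ t)) (g := fun t => f (xcoef k t))).
- by apply: (lcomp (f := xcoef k)); apply: linearP.
- by apply: lcomp; apply: linearP.
by move=> v b; rewrite tmapE !xcoefE linearZ.
Qed.

Lemma tens_exact (U V W : lmodType K) (f : {linear U -> V}) (g : {linear V -> W}) :
  exact_at f g -> exact_at (tmap f (@idfun Breg)) (tmap g (@idfun Breg)).
Proof.
move=> fg t; split=> [gt|[u <-]]; last first.
  apply: xcoef_inj => k _; rewrite !xcoef_map linear0; apply: (fg _).2.
  by exists (xcoef k u).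
have h k : exists u, f u = xcoef k t.
  by apply: (fg _).1; rewrite -xcoef_map gt linear0.
have [y yP] := choice h; exists (\sum_(k < n) xtens (y k) k).
rewrite [RHS]xcoef_sum linear_sum; apply: eq_bigr => k _.
by rewrite [LHS]tmapE yP.
Qed.

Lemma tens_surj (V W : lmodType K) (f : {linear V -> W}) :
  (forall w, exists v, f v = w) ->
  forall t, exists u, tmap f (@idfun Breg) u = t.
Proof.
move=> fs t; have [y yP] := choice (fun k => fs (xcoef k t)).
exists (\sum_(k < n) xtens (y k) k).
rewrite [RHS]xcoef_sum linear_sum; apply: eq_bigr => k _.
by rewrite [LHS]tmapE yP.
Qed.

Definition stdmap (V : lmodType K) (j : nat) : {linear tens V Breg -> tens V Breg} :=
  tmap (@idfun V) (kmap (@stdres_d K n j)).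

Definition stdexp (j : nat) : nat := if odd j then n.-1 else 1%N.

Lemma stdmap_pure (V : lmodType K) j (v : V) (b : Breg) :
  stdmap V j (v \ot b) = v \ot (x ^+ stdexp j * (b : B) : Breg).
Proof.
rewrite [LHS]tmapE; congr (_ \ot _).
by rewrite /stdexp /kmap /= /stdres_mul; case: odd; rewrite ?expr1.
Qed.

Lemma stdmap_nat (V W : lmodType K) (f : {linear V -> W}) j t :
  tmap f (@idfun Breg) (stdmap V j t) = stdmap W j (tmap f (@idfun Breg) t).
Proof.
move: t; apply: (tens_ext (f := fun t => tmap _ _ (stdmap _ _ t))
  (g := fun t => stdmap _ _ (tmap _ _ t))).
- by apply: (lcomp (f := tmap _ _)); apply: linearP.
- by apply: lcomp; apply: linearP.
by move=> v b; rewrite !(tmapE, stdmap_pure).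
Qed.

Lemma xcoef_stdmap (V : lmodType K) j k (t : tens V Breg) :
  (stdexp j + k < n)%N -> xcoef (stdexp j + k) (stdmap V j t) = xcoef k t.
Proof.
move=> lt; move: t; apply: (tens_ext (f := fun t => xcoef _ (stdmap _ _ t))).
- by apply: (lcomp (f := xcoef _)); apply: linearP.
- exact: linearP.
by move=> v b; rewrite stdmap_pure !xcoefE tcoefMX.
Qed.

Lemma xcoef0_stdmap0 (V : lmodType K) (t : tens V Breg) :
  (1 < n)%N -> xcoef 0 (stdmap V 0 t) = 0.
Proof.
move=> n_gt1; move: t; apply: (tens_ext (f := fun t => xcoef _ (stdmap _ _ t)) (g := fun=> 0)).
- by apply: (lcomp (f := xcoef _)); apply: linearP.
- by move=> c u v; rewrite scaler0 addr0.
by move=> v b; rewrite stdmap_pure xcoefE expr1 tcoef_xM0 // scale0r.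
Qed.

Lemma stdexpD j : (stdexp j + stdexp j.+1 = n)%N.
Proof. by rewrite /stdexp /=; case: odd => /=; lia. Qed.

Lemma stdmap_xtens (V : lmodType K) j (v : V) k :
  stdmap V j (xtens v k) = xtens v (stdexp j + k).
Proof. by rewrite [LHS]stdmap_pure /xtens exprD. Qed.

Lemma stdmap_comp (V : lmodType K) j t : stdmap V j (stdmap V j.+1 t) = 0.
Proof.
move: t; apply: (tens_ext (f := fun t => stdmap _ _ (stdmap _ _ t)) (g := fun=> 0)).
- by apply: lcomp; apply: linearP.
- by move=> c u v; rewrite scaler0 addr0.
by move=> v b; rewrite !stdmap_pure mulrA -exprD stdexpD tpoly_xn // mul0r pure0r.
Qed.

Lemma stdmap_image (V : lmodType K) j (t : tens V Breg) :
  (forall k, (k < stdexp j)%N -> xcoef k t = 0) -> exists u, stdmap V j u = t.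
Proof.
move=> h; pose m := stdexp j; pose c k := xtens (xcoef (m + k) t) k.
have mn : (m <= n)%N by rewrite -(stdexpD j) leq_addr.
exists (\sum_(k < n - m) c k); rewrite linear_sum.
rewrite [RHS]xcoef_sum -[in RHS](big_mkord xpredT (fun k => xtens (xcoef k t) k)).
have t0 : \sum_(0 <= k < m) xtens (xcoef k t) k = 0.
  by rewrite big_nat big1 // => k lt; rewrite h //; exact: pure0l.
rewrite (@big_cat_nat _ _ _ m) //= t0 add0r.
rewrite -[X in \sum_(X <= _ < _) _]add0n big_addn big_mkord.
apply: eq_bigr => k _.
by rewrite [LHS](stdmap_xtens j) addnC.
Qed.

Lemma stdmap_exact (V : lmodType K) j : exact_at (stdmap V j.+1) (stdmap V j).
Proof.
move=> t; split=> [t0|[u <-]]; last exact: stdmap_comp.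
apply: stdmap_image => k lt; rewrite -(xcoef_stdmap (j := j)) ?t0 ?linear0 //.
by rewrite -(stdexpD j) ltn_add2l.
Qed.

End Coordinates.

Lemma total_exact (K : fieldType) (C : nat -> lmodType K) (L : lmodType K)
  (D : forall i, {linear C i.+1 -> C i}) (aug : {linear C 0%N -> L})
  (E : forall i, nat -> {linear C i -> C i}) (EL : nat -> {linear L -> L})
  (DE : forall i j c, D i (E i.+1 j c) = E i j (D i c))
  (augE : forall j c, aug (E 0%N j c) = EL j (aug c))
  (EE : forall i j c, E i j (E i j.+1 c) = 0)
  (augS : forall l, exists c, aug c = l)
  (ex0 : exact_at (D 0%N) aug) (exS : forall i, exact_at (D i.+1) (D i))
  (k : nat) (w : forall i, C i) :
  (exists l, EL k l = aug (w 0%N)) ->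
  (forall i, (i < k)%N -> D i (w i.+1) + (-1) ^+ i *: E i (k.-1 - i)%N (w i) = 0) ->
  exists u : forall i, C i, forall i, (i <= k)%N ->
    D i (u i.+1) + (-1) ^+ i *: E i (k - i)%N (u i) = w i.
Proof.
move=> [l lP] w0; have [u0 u0P] := augS l.
pose eqn i (c : C i) (y : C i.+1) :=
  D i y = w i - (-1) ^+ i *: E i (k - i)%N c.
pose step i (c : C i) : C i.+1 :=
  if pselect (exists y, eqn i c y) is left h then projT1 (cid h) else 0.
have stepP i c : (exists y, eqn i c y) -> eqn i c (step i c).
  by rewrite /step; case: pselect => // h _; case: cid.
have [u [u00 uS]] : exists u : forall i, C i,
    u 0%N = u0 /\ forall i, u i.+1 = step i (u i).
  by exists (nat_rect C u0 step).
have uP i : (i <= k)%N -> eqn i (u i) (u i.+1).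
  elim: i => [_|i ih ik]; rewrite [X in eqn _ _ X]uS; apply: stepP.
    apply: (ex0 _).1; rewrite expr0 scale1r subn0 linearB /= augE u00 u0P lP.
    exact: subrr.
  have {}ih : D i (u i.+1) = _ := ih (ltnW ik).
  apply: (exS _ _).1; rewrite linearB [X in _ - X]linearZ /= DE ih.
  have := w0 i ik; have -> : (k.-1 - i = k - i.+1)%N by lia.
  move/eqP; rewrite addr_eq0 => /eqP ->; rewrite linearB linearZ /=.
  have -> : (k - i = (k - i.+1).+1)%N by lia.
  rewrite [E _ _ (_ *: _)]linearZ /= EE scaler0 subr0 exprS mulN1r scaleNr opprK.
  by rewrite scalerN addNr.
by exists u => i ik; rewrite uP // subrK.
Qed.

Section TotalComplex.
Variables (K : fieldType) (n : nat) (A : algType K).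
Hypothesis n_gt1 : (1 < n)%N.
Let n_gt0 : (0 < n)%N := ltnW n_gt1.
Local Notation B := (tpoly K n).
Local Notation Breg := (kmod (B^o : lmodType B)).
Variable tau : twisting_map A B.
Variables (P : nat -> lmodType A) (d : forall i, {linear P i.+1 -> P i}).
Variable th : forall i, {linear tens B (kmod (P i)) -> tens (kmod (P i)) B}.
Hypothesis cP : forall i, compatible tau (th i).
Local Notation X := (tpc cP (@stdres K n)).
Local Notation C := (fun i => tens (kmod (P i)) Breg).

Fact bideg_at_proof k i : (i <= k)%N -> (k - i < k.+1)%N.
Proof. by move=> _; rewrite ltnS leq_subr. Qed.

Fact bideg_at_sum k i (h : (i <= k)%N) :
  ((Ordinal (h : (i < k.+1)%N)) + (Ordinal (bideg_at_proof h)) == k)%N.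
Proof. by rewrite /= subnKC. Qed.

Definition bideg_at k i (h : (i <= k)%N) : bideg k :=
  exist _ (Ordinal (h : (i < k.+1)%N), Ordinal (bideg_at_proof h)) (bideg_at_sum h).

Definition component k (w : X k) (i : nat) : C i :=
  if pselect (i <= k)%N is left h then w (bideg_at h) else 0.

Lemma componentE k (w : X k) (p : bideg k) : component w (bdl p) = w p.
Proof.
case: p => -[[i hi] [j hj]] e; rewrite /component /bdl /=.
case: pselect => [h|]; last by case.
have ej : (j = k - i)%N by move: e => /eqP /= <-; rewrite addKn.
subst j; rewrite /bideg_at; move: (bideg_at_sum h) (bideg_at_proof h) => /= e' hj'.
move: h e'; rewrite (bool_irrelevance hj' hj) => h; rewrite (bool_irrelevance h hi) => e'.
by rewrite (bool_irrelevance e' e).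
Qed.

Lemma component_eq k (w w' : X k) :
  (forall i, (i <= k)%N -> component w i = component w' i) -> w = w'.
Proof.
move=> h; apply: (@dsumP _ _ (fun p : bideg k => twmod (cP (bdl p)) B^o)) => p.
by rewrite -!componentE h // -ltnS ltn_ord.
Qed.

Definition assemble k (c : forall i, C i) : X k := [ffun p : bideg k => c (bdl p)].

Lemma component_assemble k (c : forall i, C i) i : (i <= k)%N ->
  component (assemble k c) i = c i.
Proof.
by move=> h; rewrite -[LHS]/(component _ (bdl (bideg_at h))) componentE ffunE.
Qed.

Local Notation D i := (tmap (kmap (d i)) (@idfun Breg)).
Local Notation E i := (stdmap n (kmod (P i))).

Lemma component_d k (w : X k.+1) i : (i <= k)%N ->
  component (tpc_d d cP (@stdres_d K n) k w) i =
  D i (component w i.+1) + (-1) ^+ i *: E i (k - i)%N (component w i).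
Proof.
move=> h; rewrite -[LHS]/(component _ (bdl (bideg_at h))) componentE ffunE.
rewrite -(componentE w (bideg_incl (bideg_at h))).
by rewrite -(componentE w (bideg_incr (bideg_at h))).
Qed.

Variables (M : lmodType A) (mu : {linear P 0%N -> M}).
Hypothesis resP : resolution d mu.

Lemma tensk_augE (t : C 0%N) :
  tensk (tmap (kmap mu) (kmap (@stdres_aug K n)) t) = mu (xcoef 0 t) :> kmod M.
Proof.
move: t; apply: (tens_ext (f := fun t => tensk (tmap _ _ t))
  (g := fun t => kmap mu (xcoef 0 t))).
- apply: (lcomp (f := @tensk K n (kmod M))); last exact: linearP.
  exact/tlift_linear/tensk_bilin.
- by apply: (lcomp (f := kmap mu)); apply: linearP.
move=> z b; rewrite tmapE xcoefE [LHS](tlift_pure _ _ (tensk_bilin n _)).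
by rewrite [RHS](linearZ_LR (kmap mu)).
Qed.

Lemma tpc_augE (w : X 0%N) :
  tensk (tpc_aug cP mu (@stdres_aug K n) w) = mu (xcoef 0 (component w 0%N)).
Proof.
rewrite -[component w 0]/(component w (bdl bideg0)) componentE /tpc_aug.
exact: tensk_augE.
Qed.

Let DE i j (c : C i.+1) : D i (E i.+1 j c) = E i j (D i c).
Proof. exact: (stdmap_nat (kmap (d i))). Qed.

Let exS i : exact_at (D i.+1) (D i).
Proof.
exact: (tens_exact n_gt0 (f := kmap (d i.+1)) (g := kmap (d i))
  (@res_exactS _ _ _ _ _ resP i)).
Qed.

Let aug : {linear C 0%N -> tens (kmod M) Breg} := tmap (kmap mu) (@idfun Breg).

Let ex0 : exact_at (D 0%N) aug.
Proof. exact: (tens_exact n_gt0 (f := kmap (d 0)) (g := kmap mu) (res_exact0 resP)). Qed.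

Let augS l : exists c, aug c = l.
Proof. exact: (tens_surj n_gt0 (f := kmap mu) (res_mu_surj resP)). Qed.

Let total k (w : X k) :
  (exists l, stdmap n (kmod M) k l = aug (component w 0%N)) ->
  (forall i, (i < k)%N -> D i (component w i.+1) +
     (-1) ^+ i *: E i (k.-1 - i)%N (component w i) = 0) ->
  exists u, tpc_d d cP (@stdres_d K n) k u = w.
Proof.
move=> h0 hS.
have [u uP] := total_exact (E := fun i => E i) DE (stdmap_nat (kmap mu))
  (fun i => stdmap_comp n_gt0 (V := kmod (P i))) augS ex0 exS h0 hS.
exists (assemble k.+1 u); apply: component_eq => i ik.
by rewrite component_d // !component_assemble ?uP // ltnW.
Qed.

Lemma tpc_aug_surj m : exists w, tensk (tpc_aug cP mu (@stdres_aug K n) w) = m :> M.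
Proof.
have [z <-] := res_mu_surj resP m.
pose c i : C i := if i is 0 then (z : kmod (P 0%N)) \ot (1 : Breg) else 0.
exists (assemble 0 c); rewrite tpc_augE component_assemble // xcoefE -(expr0 (xbar K n)).
by rewrite tcoefX // eqxx scale1r.
Qed.

Lemma tpc_exact0 : exact_at (tpc_d d cP (@stdres_d K n) 0)
  (fun w => tensk (tpc_aug cP mu (@stdres_aug K n) w) : M).
Proof.
move=> w; split=> [|[u <-]].
  rewrite tpc_augE => w0; apply: total => //; apply: (stdmap_image n_gt0) => k.
  by rewrite ltnS leqn0 => /eqP ->; rewrite xcoef_map.
rewrite tpc_augE component_d // expr0 scale1r -[LHS](xcoef_map (kmap mu)) linearD /=.
rewrite (ex0 _).2 ?add0r; last by exists (component u 1).
by rewrite stdmap_nat xcoef0_stdmap0.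
Qed.

Lemma tpc_exactS k : exact_at (tpc_d d cP (@stdres_d K n) k.+1)
  (tpc_d d cP (@stdres_d K n) k).
Proof.
have comp0 (w : X k.+1) : tpc_d d cP (@stdres_d K n) k w = 0 <->
   forall i, (i < k.+1)%N -> D i (component w i.+1) +
     (-1) ^+ i *: E i (k - i)%N (component w i) = 0.
  split=> [w0 i ik|h].
    rewrite -component_d // w0.
    by rewrite /component; case: pselect => // h; rewrite ffunE.
  apply: component_eq => i ik; rewrite component_d // h //.
  by rewrite /component; case: pselect => // h'; rewrite ffunE.
move=> w; split=> [/comp0 w0|[u <-]]; last first.
  apply/comp0 => i ik; rewrite !component_d ?ltnS ?leqW //.
  rewrite !linearD !linearZ /= (@exS i _).2 ?add0r; last by exists (component u i.+2).
  rewrite subSS subSn // stdmap_comp // !scaler0 addr0.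
  by rewrite DE exprS mulN1r scaleNr addNr.
apply: total => //; apply: (stdmap_exact n_gt0 _ _).1.
have := congr1 aug (w0 0%N isT); rewrite linear0 linearD linearZ /=.
rewrite (ex0 _).2 ?add0r; last by exists (component w 1).
by rewrite expr0 scale1r subn0 stdmap_nat.
Qed.

End TotalComplex.

Lemma tmap_id (K : fieldType) (U V : lmodType K) (t : tens U V) :
  tmap (@idfun U) (@idfun V) t = t.
Proof. exact: tens_id_bilin. Qed.

Section TpcLinear.
Variables (K : fieldType) (A B : algType K) (tau : twisting_map A B).
Variables (P : nat -> lmodType A) (dP : forall i, {linear P i.+1 -> P i}).
Variable th : forall i, {linear tens B (kmod (P i)) -> tens (kmod (P i)) B}.
Hypothesis cP : forall i, compatible tau (th i).
Hypothesis chain : forall i (t : tens B (kmod (P i.+1))),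
  tmap (kmap (dP i)) (@idfun B) (th i.+1 t) =
  th i (tmap (@idfun B) (kmap (dP i)) t).
Variables (Q : nat -> lmodType B) (dQ : forall j, {linear Q j.+1 -> Q j}).

Lemma tpc_d_linear k : linear (tpc_d dP cP dQ k).
Proof.
move=> t u v.
apply: (@dsumP _ _ (fun p : bideg k => twmod (cP (bdl p)) (Q (bdr p)))) => p.
have lin j := @dsum_linE _ _ (fun p : bideg j => twmod (cP (bdl p)) (Q (bdr p))) t.
rewrite [RHS]lin !ffunE.
have hP (w : twmod (cP (bdl p).+1) (Q (bdr p))) :
   tmap (kmap (dP (bdl p))) (@idfun (kmod (Q (bdr p)))) (t *: w) =
   twact (cM := cP (bdl p)) (N := Q (bdr p)) t
    (tmap (kmap (dP (bdl p))) (@idfun (kmod (Q (bdr p)))) w).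
  exact: (twact_natural (f := dP (bdl p)) (cP _)
    (idfun : {linear Q (bdr p) -> Q (bdr p)}) (@chain (bdl p))).
have hQ (w : twmod (cP (bdl p)) (Q (bdr p).+1)) :
   tmap (@idfun (kmod (P (bdl p)))) (kmap (dQ (bdr p))) (t *: w) =
   twact (cM := cP (bdl p)) (N := Q (bdr p)) t
    (tmap (@idfun (kmod (P (bdl p)))) (kmap (dQ (bdr p))) w).
  apply: (twact_natural (f := (idfun : {linear P (bdl p) -> P (bdl p)})) (cP _)
    (dQ (bdr p))) => s.
  exact: etrans (tmap_id _) (esym (congr1 (th _) (tmap_id s))).
have hPD w w' : tmap (kmap (dP (bdl p))) (@idfun (kmod (Q (bdr p)))) (w + w') =
    tmap (kmap (dP (bdl p))) (@idfun (kmod (Q (bdr p)))) w +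
    tmap (kmap (dP (bdl p))) (@idfun (kmod (Q (bdr p)))) w' by exact: linearD.
have hQD w w' : tmap (@idfun (kmod (P (bdl p)))) (kmap (dQ (bdr p))) (w + w') =
    tmap (@idfun (kmod (P (bdl p)))) (kmap (dQ (bdr p))) w +
    tmap (@idfun (kmod (P (bdl p)))) (kmap (dQ (bdr p))) w' by exact: linearD.
rewrite hPD hQD hP hQ scalerDr addrACA.
congr (_ + _); rewrite addrC.
have tl := twact_linear (cP (bdl p)) (N := Q (bdr p)) t ((-1) ^+ bdl p).
by rewrite -tl addrC.
Qed.
End TpcLinear.

Section Augmentation.
Variables (K : fieldType) (n : nat) (n_gt1 : (1 < n)%N).
Variables (A : algType K) (E : trunc_ore n A).
Variables (M : lmodType (ore_alg E n_gt1)).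
Variables (P : nat -> lmodType A) (mu : {linear P 0%N -> ore_resA M}).
Variables (sg : forall i, {linear P i -> restr (ore_sigma E) (P i)}).
Variables (dl : forall i, {linear kmod (P i) -> kmod (P i)}).
Hypothesis dl_mu : forall z, mu (dl 0%N z) = ore_x (mu z).
Hypothesis cP : forall i, compatible (ore_twisting E n_gt1) (ore_tauP (sg i) (dl i)).
Local Notation tau := (ore_twisting E n_gt1).
Local Notation B := (tpoly K n).
Local Notation x := (xbar K n : B).
Local Notation X0 := (twmod (cP 0) (B^o : lmodType B)).

Let F (w : X0) : M := mu (xcoef 0 w).
Let n_gt0 := ltnW n_gt1.

Let F_D u v : F (u + v) = F u + F v.
Proof. by rewrite /F !linearD. Qed.

Let F_A a w : F (inA tau a *: w) = inA tau a *: F w.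
Proof.
elim/tens_ind: w => [|u v hu hv|z q].
- by rewrite scaler0 /F !linear0 scaler0.
- by rewrite scalerDr !F_D hu hv scalerDr.
rewrite twact_inA /F !xcoefE.
pose az : kmod (P 0%N) := a *: (z : P 0%N).
have -> : tcoef (q : B) 0 *: az = a *: ((tcoef (q : B) 0 *: z : kmod (P 0%N)) : P 0%N).
  by rewrite !kmodE /az !scalerA mulr_algl mulr_algr.
exact: linearZ_LR mu _ _.
Qed.

Let F_x w : F (inB tau x *: w) = inB tau x *: F w.
Proof.
elim/tens_ind: w => [|u v hu hv|z q].
- by rewrite scaler0 /F !linear0 scaler0.
- by rewrite scalerDr !F_D hu hv scalerDr.
have thx : ore_tauP (sg 0) (dl 0) (x \ot z) = skmap (sg 0) z \ot x + dl 0 z \ot 1.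
  by rewrite -{1}[x]expr1 [LHS]ore_twistX //= ore_stepE mulr1.
have bl := twact_inB_bilin (kmod (P 0%N)) (q : kmod (B^o : lmodType B)).
rewrite twact_inB thx (tens_addE (tlift_linear bl)) !(tlift_pure _ _ bl).
have q1 : tcoef (1 * (q : B)) 0 = tcoef (q : B) 0 by rewrite mul1r.
have qx := tcoef_xM0 n_gt0 (q : B) n_gt1.
rewrite /F linearD /= !xcoefE [X in X *: skmap _ _]qx [X in X *: dl _ _]q1 scale0r add0r.
by rewrite -linearZ dl_mu.
Qed.

Lemma aug_linear : linear F.
Proof.
pose Q t := forall w, F (t *: w) = t *: F w.
have QD t u : Q t -> Q u -> Q (t + u) by move=> ht hu w; rewrite !scalerDl F_D ht hu.
have Q0 : Q 0 by move=> w; rewrite !scale0r /F !linear0.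
have QM t u : Q t -> Q u -> Q (t * u) by move=> ht hu w; rewrite -!scalerA ht hu.
have Qx k : Q (inB tau (x ^+ k)).
  elim: k => [|k ih]; first by move=> w; rewrite expr0 !(@scale1r (ore_alg E n_gt1)).
  by rewrite exprS inBM; apply: QM.
suff QT t : Q t by move=> t u v; rewrite F_D QT.
elim/tens_ind: t => [|t u ht hu|a b]; [exact: Q0|exact: QD|].
rewrite (tpoly_sum n_gt0 b).
elim/big_ind: _ => [|b1 b2 h1 h2|k _].
- by rewrite pure0r.
- by have := pureEr 1 a b1 b2; rewrite !scale1r => ->; exact: QD.
have -> : a \ot (tcoef b k *: x ^+ k) = inA tau (tcoef b k *: a) * inB tau (x ^+ k).
  rewrite inA_inB.
  have := pureEr (tcoef b k) a (x ^+ k) 0; rewrite pure0r !addr0 => ->.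
  by have := pureEl (tcoef b k) a 0 (x ^+ k); rewrite pure0l !addr0 => ->.
by apply: QM => // w; exact: F_A.
Qed.

End Augmentation.

Theorem theorem3p10 (K : fieldType) (n : nat) (n_gt1 : (1 < n)%N)
  (A : algType K) (E : trunc_ore n A)
  (M : lmodType (ore_alg E n_gt1))
  (phi : {linear ore_resA M -> restr (ore_sigma E) (ore_resA M)})
  (phiV : M -> M) (phiK : cancel phi phiV) (phiVK : cancel phiV phi)
  (compM : compatible (ore_twisting E n_gt1) (ore_tauM phi))
  (P : nat -> lmodType A) (d : forall i, {linear P i.+1 -> P i})
  (mu : {linear P 0%N -> ore_resA M})
  (resP : free_resolution d mu)
  (sg : forall i, {linear P i -> restr (ore_sigma E) (P i)})
  (sg_d : forall i z, d i (sg i.+1 z) = sg i (d i z))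
  (sg_mu : forall z, phiV (mu (sg 0%N z)) = mu z)
  (dl : forall i, {linear kmod (P i) -> kmod (P i)})
  (dl_d : forall i z, d i (dl i.+1 z) = dl i (d i z))
  (dl_mu : forall z, mu (dl 0%N z) = ore_x (mu z))
  (dl_act : forall i (a : A) (z : P i),
    dl i (a *: z) = ore_sigma E a *: (dl i z : P i) + ore_delta E a *: z)
  (compP : compatible_resolution (ore_twisting E n_gt1) (ore_tauM phi) d mu
    (fun i => ore_tauP (sg i) (dl i)))
  (sg_bij : forall i, bijective (sg i)) :
  projective_resolution
    (tpc_d d (cr_compat compP) (@stdres_d K n))
    (fun w => tensk (tpc_aug (cr_compat compP) mu (@stdres_aug K n) w) : M).

Proof.
have [resM freeP] := resP.
split; last first.
  move=> k; apply: dsum_projective => p; apply: twmod_projective.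
  exact/free_projective/freeP.
split.
- move=> k; apply: tpc_d_linear; exact: cr_chain compP.
- move=> t u v; rewrite !tpc_augE.
  have := aug_linear dl_mu (cP := cr_compat compP) t (u bideg0) (v bideg0).
  have e w : component w 0%N = w bideg0 := componentE w bideg0.
  by rewrite !e dsum_linE.
- move=> m; exact: (tpc_aug_surj n_gt1 (cr_compat compP) resM m).
- exact: (tpc_exact0 n_gt1 (cP := cr_compat compP) resM).
- move=> k; exact: (tpc_exactS n_gt1 (cP := cr_compat compP) resM).
Qed.
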